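(* Let $t_0$ be a labeled cotree with $k$ leaves, $n_v$ internal nodes, $n_=$ edges joining internal nodes with equal decorations and $n_{\neq}$ edges joining internal nodes with different decorations. Let $\mathcal V_{t_0}$ be the class of tuples $(t,a;\ell_1,\dots,\ell_k)$ where $t$ is a labeled canonical cotree, $a$ is a root-preserving automorphism of $t$, and $\ell_1,\dots,\ell_k$ are distinct leaves of $t$ such that (i) they induce the cotree $t_0$, and (ii) all deepest common ancestors of (at least two of) the marked leaves, and all their children having a marked leaf among their descendants, are fixed by $a$; let $V_{t_0}$ be its exponential generating function (size = number of leaves of $t$). Then $$V_{t_0}=U^\star\,(2U+1-z)^{n_v}\,(U^\bullet)^k\,(U^{\mathrm{odd}})^{n_=}\,(U^{\mathrm{even}})^{n_{\neq}},$$ where $U^\bullet(z)=zU'(z)$.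
   Context: A cotree is a rooted non-plane tree whose internal nodes have at least two children and each carry a decoration $0$ or $1$; labeled if its $n$ leaves are labeled $1,\dots,n$. It is canonical if every child of a node decorated $0$ (resp. $1$) is a leaf or decorated $1$ (resp. $0$). Induced cotree of $(t,(\ell_1,\dots,\ell_k))$: the labeled cotree with leaves $\ell_i$ (labeled $i$) and internal nodes the nodes of $t$ that are deepest common ancestors of at least two $\ell_i$, with ancestor relation and decorations inherited. An automorphism of a rooted tree is a bijection of its nodes preserving adjacency and fixing the root (not necessarily preserving labels). $\mathcal U$ is the class of pairs $(t,a)$ with $t$ a non-plane rooted tree with leaves labeled $1,\dots,n$, internal nodes having at least two children, and $a$ an automorphism of $t$; $U(z)$ is its exponential generating function by number of leaves. $U^\star(z)=\sum_{n\ge1}\frac{c_n}{(n-1)!}z^{n-1}$, $U^{\mathrm{even}}(z)=\sum_{n\ge1}\frac{c^e_n}{(n-1)!}z^{n-1}$, $U^{\mathrm{odd}}(z)=\sum_{n\ge1}\frac{c^o_n}{(n-1)!}z^{n-1}$, where $c_n$ counts $(t,a)\in\mathcal U$ with leaves labeled $1,\dots,n$ such that leaf $n$ is fixed by $a$, and $c^e_n$ (resp. $c^o_n$) those where moreover leaf $n$ is at even (resp. odd) distance from the root.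
   Formalization: The cotree t_0 is assumed to have k ≥ 2 leaves; for k = 1 (a single leaf) the formula fails, since V = 2zU' − z = z + 4z² + … while U*·U^• = z + 3z² + …. *)

(* Defs.v *)
From HB Require Import structures.
From mathcomp Require Import all_boot all_order all_fingroup all_algebra.
From mathcomp Require Import zify.

Set Implicit Arguments.
Unset Strict Implicit.
Unset Printing Implicit Defensive.

Import GRing.Theory.

(* The node set is an arbitrary finite type [N]; the (non-plane) rooted tree structure
   is a parent map, with the convention that the root is its own parent.  The
   leaf labels [1, ..., n] are shifted to ['I_n]. *)

Record ltree (n : nat) (N : finType) := LTree {
  troot : N;
  par : {ffun N -> N};
  lab : {ffun 'I_n -> N}
}.

Section LTreeFinite.
Variables (n : nat) (N : finType).

Definition ltree_val (t : ltree n N) := (troot t, par t, lab t).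
Definition ltree_of (u : N * {ffun N -> N} * {ffun 'I_n -> N}) : ltree n N :=
  LTree u.1.1 u.1.2 u.2.

Lemma ltree_valK : cancel ltree_val ltree_of.
Proof. by case. Qed.

HB.instance Definition _ := Finite.copy (ltree n N) (can_type ltree_valK).
End LTreeFinite.

Section LTree.
Variables (n : nat) (N : finType).
Implicit Types (t : ltree n N) (x y : N).

Definition child t x y : bool := (y != troot t) && (par t y == x).
Definition children t x : {set N} := [set y | child t x y].
Definition leaf t x : bool := children t x == set0.
Definition adj t x y : bool := child t x y || child t y x.

(* [x] is an ancestor of [y], reflexively. *)
Definition anc t x y : bool := fconnect (par t) y x.

(* The least [i] such that [iter i (par t) x = troot t]. *)
Definition depth t x : nat := findex (par t) x (troot t).

Definition is_ltree t : bool :=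
  [&& par t (troot t) == troot t,
      [forall x, anc t (troot t) x],
      [forall x, leaf t x || (2 <= #|children t x|)],
      injectiveb (lab t)
    & [forall x, leaf t x == (x \in codom (lab t))]].

Definition is_aut t (a : {perm N}) : bool :=
  [forall x, forall y, adj t (a x) (a y) == adj t x y]
  && (a (troot t) == troot t).

Definition is_dca t (S : {set N}) x : bool :=
  [forall l in S, anc t x l]
  && [forall y, [forall l in S, anc t y l] ==> anc t y x].

End LTree.

Definition ltree_iso (n : nat) (N N' : finType) (s : N -> N')
    (t : ltree n N) (t' : ltree n N') : bool :=
  [&& s (troot t) == troot t',
      [forall x, s (par t x) == par t' (s x)]
    & [forall i, s (lab t i) == lab t' i]].

(* [None] on the leaves, [Some false] and [Some true] for the decorations 0
   and 1 of the internal nodes. *)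
Record cotree (n : nat) (N : finType) := Cotree {
  ctree :> ltree n N;
  dec : {ffun N -> option bool}
}.

Section CotreeFinite.
Variables (n : nat) (N : finType).

Definition cotree_val (t : cotree n N) := (ctree t, dec t).
Definition cotree_of (u : ltree n N * {ffun N -> option bool}) : cotree n N :=
  Cotree u.1 u.2.

Lemma cotree_valK : cancel cotree_val cotree_of.
Proof. by case. Qed.

HB.instance Definition _ := Finite.copy (cotree n N) (can_type cotree_valK).
End CotreeFinite.

Section Cotree.
Variables (n : nat) (N : finType).
Implicit Types (t : cotree n N).

Definition is_cotree t : bool :=
  is_ltree t && [forall x, (dec t x == None) == leaf t x].

Definition canonical t : bool :=
  [forall x, forall y, child t x y ==> (leaf t y || (dec t y != dec t x))].

Definition n_int t : nat := #|[set x | ~~ leaf t x]|.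

Definition int_edges t : {set N * N} :=
  [set e | [&& child t e.1 e.2, ~~ leaf t e.1 & ~~ leaf t e.2]].
Definition n_eq t : nat := #|[set e in int_edges t | dec t e.1 == dec t e.2]|.
Definition n_neq t : nat := #|[set e in int_edges t | dec t e.1 != dec t e.2]|.

Variable k : nat.
Implicit Types (l : {ffun 'I_k -> N}).

Definition dcas t l : {set N} :=
  [set x | [exists A : {set 'I_k}, (2 <= #|A|) && is_dca t (l @: A) x]].

(* [f] identifies [t0] with the cotree induced by the marked leaves [l]. *)
Definition induces (N0 : finType) (t0 : cotree k N0) t l : bool :=
  [exists f : {ffun N0 -> N},
    [&& injectiveb f,
        [forall i, f (lab t0 i) == l i],
        f @: [set x | ~~ leaf t0 x] == dcas t l,
        [forall x, forall y, anc t0 x y == anc t (f x) (f y)]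
      & [forall x, dec t0 x == dec t (f x)]]].

(* A child which is itself a marked leaf counts as having a marked leaf among
   its descendants. *)
Definition fixes_dcas t (a : {perm N}) l : bool :=
  [forall x in dcas t l,
    (a x == x)
    && [forall y in children t x, [exists i, anc t y (l i)] ==> (a y == y)]].

End Cotree.

(* Only the leaves carry labels, so the objects with [n] leaves are the
   isomorphism classes of structures on the node sets ['I_m]; by [ltree_card]
   it is enough to consider [m < 2 n]. *)

Lemma sum_children (n : nat) (N : finType) (t : ltree n N) :
  \sum_x #|children t x| = #|N|.-1.
Proof.
have -> : \sum_x #|children t x| = \sum_x \sum_(y | child t x y) 1.
  by apply: eq_bigr => x _; rewrite sum1dep_card.
rewrite (exchange_big_dep (fun y => y != troot t)) /=; last first.
  by move=> x y _ /andP[].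
rewrite -(cardC1 (troot t)) -sum1_card; apply: eq_big => // y yr.
rewrite (big_pred1 (par t y)) // => x /=.
by rewrite /child yr /= eq_sym.
Qed.

Lemma ltree_card (n : nat) (N : finType) (t : ltree n N) :
  is_ltree t -> #|N| < n.*2.
Proof.
case/and5P=> _ _ /forallP t2 /injectiveP labI /forallP labP.
have lE : #|[set x | leaf t x]| = n.
  rewrite -[RHS]card_ord -(card_codom labI) cardsE; apply: eq_card => x.
  by rewrite -(eqP (labP x)).
have N0 : 0 < #|N| by apply/card_gt0P; exists (troot t).
have iE : #|[set x | leaf t x]| + #|[set x | ~~ leaf t x]| = #|N|.
  rewrite -(cardsC [set x | leaf t x]); congr (_ + _).
  by apply: eq_card => x; rewrite !inE.
have : #|[set x | ~~ leaf t x]|.*2 <= \sum_x #|children t x|.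
  rewrite (bigID (fun x => leaf t x)) /= -[leqLHS]add0n leq_add //.
  rewrite -muln2 -[#|[set _ | _]|]sum1dep_card big_distrl /= leq_sum // => x xl.
  by have := t2 x; rewrite (negbTE xl).
rewrite sum_children; move: iE; rewrite lE; lia.
Qed.

Section UClass.
Variables (n : nat) (N : finType).

Definition ustruct : finType := (ltree n N * {perm N})%type.

Definition Uclass : {set ustruct} := [set u | is_ltree u.1 && is_aut u.1 u.2].

Definition Uiso : rel ustruct := fun u v =>
  [exists s : {perm N},
    ltree_iso s u.1 v.1 && [forall x, s (u.2 x) == v.2 (s x)]].

End UClass.

Definition Ucount (n : nat) (P : forall N : finType, pred (ustruct n N)) : nat :=
  \sum_(m < n.*2)
    #|equivalence_partition (@Uiso n 'I_m) [set u in Uclass n 'I_m | P _ u]|.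

(* The leaf with the largest label. *)
Definition last_leaf (n : nat) (N : finType) (t : ltree n.+1 N) : N :=
  lab t ord_max.

Definition last_fixed (n : nat) (N : finType) : pred (ustruct n.+1 N) :=
  fun u => u.2 (last_leaf u.1) == last_leaf u.1.
Definition last_fixed_odd (n : nat) (N : finType) : pred (ustruct n.+1 N) :=
  fun u => last_fixed u && odd (depth u.1 (last_leaf u.1)).
Definition last_fixed_even (n : nat) (N : finType) : pred (ustruct n.+1 N) :=
  fun u => last_fixed u && ~~ odd (depth u.1 (last_leaf u.1)).

Section VClass.
Variables (k : nat) (N0 : finType) (t0 : cotree k N0) (n : nat) (N : finType).

Definition vstruct : finType :=
  (cotree n N * {perm N} * {ffun 'I_k -> N})%type.

Definition Vclass : {set vstruct} :=
  [set v : vstruct | let: (t, a, l) := v in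
    [&& is_cotree t, canonical t, is_aut t a,
        injectiveb l, [forall i, leaf t (l i)],
        induces t0 t l & fixes_dcas t a l]].

Definition Viso : rel vstruct := fun v w =>
  let: (t, a, l) := v in let: (t', a', l') := w in
  [exists s : {perm N},
    [&& ltree_iso s t t', [forall x, dec t x == dec t' (s x)],
        [forall x, s (a x) == a' (s x)] & [forall i, s (l i) == l' i]]].

End VClass.

Definition Vcount (k : nat) (N0 : finType) (t0 : cotree k N0) (n : nat) : nat :=
  \sum_(m < n.*2) #|equivalence_partition (@Viso k n 'I_m) (Vclass t0 n 'I_m)|.

Lemma Uiso_equiv (n : nat) (N : finType) : equivalence_rel (@Uiso n N).
Proof.
apply/equivalence_relP; split=> [u|u v /existsP[s]].
  apply/existsP; exists 1%g; rewrite /ltree_iso !perm1 eqxx /=.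
  by apply/andP; split; [apply/andP; split|]; apply/forallP=> x; rewrite !perm1.
case/andP=> /and3P[/eqP sr /forallP sp /forallP sl] /forallP sa w.
apply/existsP/existsP=> -[r /andP[/and3P[/eqP rr /forallP rp /forallP rl] /forallP ra]].
- exists (s^-1 * r)%g; rewrite /ltree_iso !permM -sr permK rr eqxx /=.
  apply/andP; split; [apply/andP; split|]; apply/forallP=> x; rewrite !permM.
  + by rewrite -(eqP (rp _)) -{1}(permKV s x) -(eqP (sp _)) permK.
  + by rewrite -(eqP (sl x)) permK (eqP (rl x)).
  + by rewrite -(eqP (ra _)) -{1}(permKV s x) -(eqP (sa _)) permK.
- exists (s * r)%g; rewrite /ltree_iso !permM sr rr eqxx /=.
  apply/andP; split; [apply/andP; split|]; apply/forallP=> x; rewrite !permM.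
  + by rewrite (eqP (sp x)) (eqP (rp _)).
  + by rewrite (eqP (sl x)) (eqP (rl x)).
  + by rewrite (eqP (sa x)) (eqP (ra _)).
Qed.

Lemma Viso_equiv (k n : nat) (N : finType) : equivalence_rel (@Viso k n N).
Proof.
apply/equivalence_relP; split=> [[[t a] l]|[[t a] l] [[t' a'] l'] /existsP[s]].
  apply/existsP; exists 1%g; rewrite /ltree_iso !perm1 eqxx /=.
  by apply/and4P; split; [apply/andP; split|..]; apply/forallP=> x; rewrite !perm1.
case/and4P=> /and3P[/eqP sr /forallP sp /forallP sl] /forallP sd /forallP sa /forallP sm.
case=> [[t2 a2] l2]; apply/existsP/existsP=> -[r].
all: case/and4P=> /and3P[/eqP rr /forallP rp /forallP rl] /forallP rd /forallP ra /forallP rm.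
- exists (s^-1 * r)%g; rewrite /ltree_iso !permM -sr permK rr eqxx /=.
  apply/and4P; split; [apply/andP; split|..]; apply/forallP=> x; rewrite !permM.
  + by rewrite -(eqP (rp _)) -{1}(permKV s x) -(eqP (sp _)) permK.
  + by rewrite -(eqP (sl x)) permK (eqP (rl x)).
  + by rewrite -(eqP (rd _)) (eqP (sd _)) permKV.
  + by rewrite -(eqP (ra _)) -{1}(permKV s x) -(eqP (sa _)) permK.
  + by rewrite -(eqP (sm x)) permK (eqP (rm x)).
- exists (s * r)%g; rewrite /ltree_iso !permM sr rr eqxx /=.
  apply/and4P; split; [apply/andP; split|..]; apply/forallP=> x; rewrite !permM.
  + by rewrite (eqP (sp x)) (eqP (rp _)).
  + by rewrite (eqP (sl x)) (eqP (rl x)).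
  + by rewrite (eqP (sd x)) (eqP (rd _)).
  + by rewrite (eqP (sa x)) (eqP (ra _)).
  + by rewrite (eqP (sm x)) (eqP (rm x)).
Qed.

(* Formal power series, given by their coefficient sequences. *)
Definition fps : Type := nat -> rat.

Declare Scope fps_scope.
Delimit Scope fps_scope with fps.
Bind Scope fps_scope with fps.
Local Open Scope ring_scope.

Definition fps_const (c : rat) : fps := fun n => if n == 0%N then c else 0.
Definition fps_X : fps := fun n => (n == 1%N)%:R.
Definition fps_add (f g : fps) : fps := fun n => f n + g n.
Definition fps_sub (f g : fps) : fps := fun n => f n - g n.
Definition fps_mul (f g : fps) : fps := fun n => \sum_(i < n.+1) f i * g (n - i)%N.
Definition fps_exp (f : fps) (k : nat) : fps := iter k (fps_mul f) (fps_const 1).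
Definition fps_deriv (f : fps) : fps := fun n => n.+1%:R * f n.+1.

Notation "1" := (fps_const 1%R) : fps_scope.
Notation "2" := (fps_const 2%R) : fps_scope.
Notation "f + g" := (fps_add f g) : fps_scope.
Notation "f - g" := (fps_sub f g) : fps_scope.
Notation "f * g" := (fps_mul f g) : fps_scope.
Notation "f ^+ k" := (fps_exp f k) : fps_scope.
Notation "'z" := fps_X : fps_scope.

Definition egf (c : nat -> nat) : fps := fun n => (c n)%:R / n`!%:R.

Definition U : fps := egf (fun n => Ucount (fun N => @predT (ustruct n N))).

(* The coefficient of [z^n] involves the trees with [n + 1] leaves: the leaf with
   the largest label is not counted in the size. *)
Definition Ustar : fps := egf (fun n => Ucount (@last_fixed n)).
Definition Uodd : fps := egf (fun n => Ucount (@last_fixed_odd n)).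
Definition Ueven : fps := egf (fun n => Ucount (@last_fixed_even n)).

Definition Ubullet : fps := ('z * fps_deriv U)%fps.

Definition V (k : nat) (N0 : finType) (t0 : cotree k N0) : fps := egf (Vcount t0).

(* Main.v *)
Require Import Defs.
From mathcomp Require Import all_boot all_order all_fingroup all_algebra.
From mathcomp Require Import zify ring.

(* Since the leaf labels make the structures rigid, each isomorphism class on [m]
   nodes accounts for [m!] structures on ['I_m]; and a structure with [n] leaves has
   [n!] labelings.  So every series of the theorem is the sum over [m] of [1/m!]
   times the sum of [z^(leaves)] over the unlabeled structures on ['I_m], and a
   product of such series counts the colorings of ['I_m] with a structure of the
   prescribed kind on each color class.

   Write [f y] for the node of [t] corresponding to the node [y] of [t0].  Cutting all
   edges of [t] below the nodes [f v], [v] internal, leaves: for each internal [y] a stem,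
   i.e. a tree having [f y] as a leaf fixed by the automorphism; for each leaf [y]
   a tree pointed at [f y]; and for each internal [v] the forest of the trees without
   marked leaf hanging from [f v].  Condition (ii) says exactly that the automorphism
   preserves all these pieces.  The stems of the non-root nodes [y] have even or odd height
   according to whether the decorations of [y] and of its parent differ or agree, since
   decorations alternate along the branches of [t].  Finally, a forest with at
   least two trees is a tree with its root removed, so that the forests have the
   series [1 + U + (U - z)]. *)

Set Implicit Arguments.
Unset Strict Implicit.
Unset Printing Implicit Defensive.

Import GRing.Theory Num.Theory.

(** * Counting *)

Lemma big_ord_widen_idx (R : Type) (idx : R) (op : Monoid.law idx) (F : nat -> R) m n :
    m <= n -> (forall i, m <= i -> F i = idx) ->
  \big[op/idx]_(i < n) F i = \big[op/idx]_(i < m) F i.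
Proof.
move=> mn F_idx; rewrite -!(big_mkord xpredT) (big_cat_nat (n := m)) //=.
rewrite [X in op _ X]big_nat_cond [X in op _ X]big1 ?Monoid.mulm1 // => i.
by rewrite andbT => /andP[/F_idx].
Qed.

Lemma card_fibration (T G L : finType) (S : {set T}) (B : {set G})
    (fiber : G -> {set L}) (base : T -> G) (coord : T -> L) :
    {in S, forall v, base v \in B /\ coord v \in fiber (base v)} ->
    {in S &, injective (fun v => (base v, coord v))} ->
    (forall b y, b \in B -> y \in fiber b ->
       exists2 v, v \in S & base v = b /\ coord v = y) ->
  #|S| = \sum_(b in B) #|fiber b|.
Proof.
move=> maps inj surj; rewrite -sum1_card (partition_big base (mem B)) /=; last first.
  by move=> v /maps[].
apply: eq_bigr => b bB; rewrite sum1dep_card.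
rewrite -(card_in_imset (f := coord)) => [|v w]; last first.
  rewrite !inE => /andP[vS /eqP bv] /andP[wS /eqP bw] coordE.
  by apply: inj; rewrite // bv bw coordE.
apply: eq_card => y; apply/imsetP/idP => [[v + ->]|yb].
  by rewrite inE => /andP[/maps[_ yv] /eqP <-].
by have [v vS [bE yE]] := surj b y bB yb; exists v; rewrite // inE vS bE eqxx.
Qed.

Lemma card_free_classes (G T : finType) (R : rel T) (S : {set T}) (act : G -> T -> T) :
    equivalence_rel R -> (forall u v, R u v = [exists g, v == act g u]) ->
    (forall g u, u \in S -> act g u \in S) ->
    (forall u, u \in S -> injective (act^~ u)) ->
  #|equivalence_partition R S| * #|G| = #|S|.
Proof.
move=> eqR RE actS act_inj; symmetry; apply: card_uniform_partition; last first.
  by apply: equivalence_partitionP => x y z _ _ _; apply: eqR.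
move=> _ /imsetP[u uS ->]; rewrite -cardsT -(card_imset _ (act_inj u uS)).
apply: eq_card => v; rewrite !inE RE; apply/andP/imsetP => [[_]|[g _ ->]].
  by case/existsP=> g /eqP ->; exists g.
by split; [exact: actS|apply/existsP; exists g].
Qed.

Definition labelings (n : nat) (N : finType) (L : {set N}) : {set {ffun 'I_n -> N}} :=
  [set f : {ffun 'I_n -> N} | injectiveb f & [set x in codom f] == L].

Section Labelings.
Variables (n : nat) (N : finType).
Implicit Types (L : {set N}) (f : {ffun 'I_n -> N}).

Lemma labelingsP L f :
  reflect (injective f /\ forall x, (x \in L) = (x \in codom f)) (f \in labelings n L).
Proof.
rewrite inE; apply: (iffP andP) => -[].
  by move=> /injectiveP f_inj /eqP <-; split=> // x; rewrite inE.
by move=> /injectiveP f_inj fL; split=> //; apply/eqP/setP=> x; rewrite inE fL.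
Qed.

Lemma labelings_card L f : f \in labelings n L -> #|L| = n.
Proof.
by case/labelingsP=> f_inj fL; rewrite -[RHS]card_ord -(card_codom f_inj); apply: eq_card.
Qed.

Lemma card_labelings L : #|labelings n L| = (#|L| == n) * n`!.
Proof.
have [Ln|Ln] := eqVneq #|L| n; last first.
  by apply: eq_card0 => f; apply: contraNF Ln => /labelings_card ->.
have -> : labelings n L = [set f : {ffun 'I_n -> N} in ffun_on (mem L) | injectiveb f].
  apply/setP=> f; apply/labelingsP/idP => [[f_inj fL]|].
    rewrite inE (introT (injectiveP f) f_inj) andbT.
    by apply/ffun_onP=> i; rewrite fL codom_f.
  rewrite inE => /andP[/ffun_onP fL /injectiveP f_inj]; split=> // x.
  have cL : codom f \subset L by apply/subsetP=> _ /codomP[i ->]; apply: fL.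
  by apply/esym/(subset_cardP _ cL); rewrite card_codom // card_ord.
by rewrite card_inj_ffuns_on card_ord Ln ffactnn mul1n.
Qed.

End Labelings.

Section PunchedLabelings.
Variables (n : nat) (N : finType) (L : {set N}) (i0 : 'I_n.+1) (x : N).
Hypothesis xL : x \in L.
Implicit Types (f : {ffun 'I_n.+1 -> N}) (g : {ffun 'I_n -> N}).

Definition punch f : {ffun 'I_n -> N} := [ffun j => f (lift i0 j)].

Definition plug g : {ffun 'I_n.+1 -> N} :=
  [ffun i => if unlift i0 i is Some j then g j else x].

Lemma plugK : cancel plug punch.
Proof. by move=> g; apply/ffunP=> j; rewrite !ffunE liftK. Qed.

Lemma punchK f : f i0 = x -> plug (punch f) = f.
Proof.
by move=> fx; apply/ffunP=> i; rewrite ffunE; case: unliftP => [j|] ->; rewrite ?ffunE.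
Qed.

Lemma punch_labelings f :
  f \in labelings n.+1 L -> f i0 = x -> punch f \in labelings n (L :\ x).
Proof.
case/labelingsP=> f_inj fL fx; apply/labelingsP; split=> [i j|y].
  by rewrite !ffunE => /f_inj/lift_inj.
rewrite !inE fL -fx; apply/andP/codomP => [[yx /codomP[i yE]]|[j ->]].
  move: yx; rewrite yE; case: (unliftP i0 i) => [j|] ->; last by rewrite eqxx.
  by exists j; rewrite ffunE.
by rewrite ffunE (inj_eq f_inj) eq_sym neq_lift codom_f.
Qed.

Lemma plug_labelings g : g \in labelings n (L :\ x) -> plug g \in labelings n.+1 L.
Proof.
case/labelingsP=> g_inj gL.
have gx j : g j != x by have := codom_f g j; rewrite -gL !inE => /andP[].
apply/labelingsP; split=> [i j|y].
  rewrite !ffunE; case: unliftP => [i'|] ->; case: unliftP => [j'|] -> //.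
  - by move/g_inj->.
  - by move=> E; have := gx i'; rewrite E eqxx.
  - by move=> E; have := gx j'; rewrite -E eqxx.
apply/idP/codomP => [yL|[i ->]]; last first.
  rewrite ffunE; case: unliftP => // j _.
  by have := codom_f g j; rewrite -gL !inE => /andP[].
have [->|yx] := eqVneq y x; first by exists i0; rewrite ffunE unlift_none.
have : y \in codom g by rewrite -gL !inE yx.
by case/codomP=> j ->; exists (lift i0 j); rewrite ffunE liftK.
Qed.

Lemma card_labelings_at :
  #|[set f in labelings n.+1 L | f i0 == x]| = (#|L| == n.+1) * n`!.
Proof.
rewrite (cardsD1 x) xL eqSS -card_labelings -(card_imset _ (can_inj plugK)).
apply: eq_card => f; rewrite inE; apply/andP/imsetP => [[fL /eqP fx]|[g gL ->]].
  by exists (punch f); rewrite ?punchK // punch_labelings.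
by rewrite plug_labelings // ffunE unlift_none.
Qed.

End PunchedLabelings.

Lemma card_labelings_pred (n : nat) (N : finType) (L : {set N}) (i0 : 'I_n.+1) (P : pred N) :
  #|[set f in labelings n.+1 L | P (f i0)]|
    = #|[set x in L | P x]| * ((#|L| == n.+1) * n`!).
Proof.
rewrite -sum1_card (partition_big (fun f : {ffun 'I_n.+1 -> N} => f i0)
  (mem [set x in L | P x])) /= => [|f]; last first.
  by rewrite !inE => /andP[/andP[_ /eqP <-] ->]; rewrite inE codom_f.
rewrite -sum_nat_const; apply: eq_bigr => x; rewrite inE => /andP[xL Px].
rewrite -(card_labelings_at i0 xL) -sum1_card; apply: eq_bigl => f; rewrite !inE.
by rewrite -andbA; apply: andb_id2l => _; case: eqP => [->|]; rewrite ?Px ?andbF.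
Qed.

(** * Sums over colorings *)

Section Colorings.
Local Open Scope ring_scope.
Variables (R : comNzRingType) (I : finType).

Lemma deriv_prod (P : I -> {poly R}) :
  (\prod_i P i)^`() = \sum_i \prod_j (if j == i then (P j)^`() else P j).
Proof.
rewrite -big_enum /= [RHS](eq_bigr (fun i =>
    \prod_(j <- enum I) (if j == i then (P j)^`() else P j)));
  last by move=> i _; rewrite big_enum.
rewrite -[RHS]big_enum /=.
elim: (enum I) (enum_uniq I) => [_|x r IHr /= /andP[xr ru]].
  by rewrite !big_nil derivC.
rewrite !big_cons derivM IHr // eqxx; congr (_ + _).
  congr (_ * _); rewrite big_seq [RHS]big_seq; apply: eq_bigr => j jr.
  by case: eqP jr xr => // -> ->.
rewrite mulr_sumr big_seq [RHS]big_seq; apply: eq_bigr => i ir.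
by rewrite big_cons; case: eqP ir xr => [-> ->|].
Qed.

Definition ffun_cons m (i : I) (c : {ffun 'I_m -> I}) : {ffun 'I_m.+1 -> I} :=
  [ffun x => if unlift ord0 x is Some y then c y else i].

Lemma sum_ffun_cons m (F : {ffun 'I_m.+1 -> I} -> R) :
  \sum_c F c = \sum_i \sum_c F (ffun_cons i c).
Proof.
rewrite pair_bigA /= (reindex (fun u => ffun_cons u.1 u.2)) //=.
exists (fun c => (c ord0, [ffun y => c (lift ord0 y)])) => [[i c] _|c _] /=.
  by congr (_, _); [rewrite ffunE unlift_none|apply/ffunP=> y; rewrite !ffunE liftK].
by apply/ffunP=> x; rewrite !ffunE; case: unliftP => [y|] -> /=; rewrite ?ffunE.
Qed.

Lemma card_color_cons m (i j : I) (c : {ffun 'I_m -> I}) :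
  #|[set x | ffun_cons i c x == j]| = ((j == i) + #|[set x | c x == j]|)%N.
Proof.
rewrite -!sum1dep_card big_mkcond /= big_ord_recl ffunE unlift_none /=.
rewrite [in RHS]big_mkcond /=; congr (_ + _)%N; first by rewrite eq_sym; case: (j == i).
by apply: eq_bigr => x _; rewrite ffunE liftK.
Qed.

(* Coloring one more point shifts one of the sequences [f i]: this is the product
   rule for exponential generating functions. *)
Lemma sum_colorings (m : nat) (f : I -> nat -> R) (P : I -> {poly R}) :
    (forall i j, (j <= m)%N -> f i j = (P i)`_j *+ j`!) ->
  \sum_(c : {ffun 'I_m -> I}) \prod_i f i #|[set x | c x == i]|
    = (\prod_i P i)`_m *+ m`!.
Proof.
elim: m f P => [|m IHm] f P fP.
  rewrite (big_pred1 [ffun x : 'I_0 => False_rect I (notF (ltn_ord x))]) => [|c]; last first.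
    by apply/esym/eqP/ffunP=> -[].
  rewrite coef0_prod; apply: eq_bigr => i _; rewrite -[RHS]mulr1n -(fP i 0%N) //.
  by congr f; apply: eq_card0 => -[].
rewrite factS mulrnA -coef_deriv deriv_prod coef_sum -sumrMnl sum_ffun_cons.
pose shift i0 i j := if i == i0 then f i j.+1 else f i j.
apply: eq_bigr => i0 _; rewrite -(IHm (shift i0)) => [|i j jm]; last first.
  rewrite /shift; case: eqP => _; last by rewrite fP // ltnW.
  by rewrite fP // coef_deriv factS mulrnA.
apply: eq_bigr => c _; apply: eq_bigr => i _.
by rewrite card_color_cons /shift; case: eqP.
Qed.

End Colorings.

(** * Forests as parent maps *)

Lemma fconnect_iterP (N : finType) (p : N -> N) x y :
  reflect (exists n, iter n p x = y) (fconnect p x y).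
Proof.
apply: (iffP idP) => [/iter_findex <-|[n <-]]; last exact: fconnect_iter.
by exists (findex p x y).
Qed.

Lemma fconnect_homo (N : finType) (T : Type) (p : N -> N) (k : N -> T) (e : rel T) :
    reflexive e -> transitive e -> (forall x, e (k x) (k (p x))) ->
  forall x y, fconnect p x y -> e (k x) (k y).
Proof.
move=> e_refl e_trans ep x y /fconnect_iterP[n <-].
by elim: n => //= n IHn; apply: e_trans IHn (ep _).
Qed.

Section Forest.
Variables (N : finType) (p : N -> N).
Implicit Types x y z : N.

(* The roots are their own parents, but not their own children. *)
Definition kids x : {set N} := [set y | (p y == x) && (y != x)].
Definition rootset : {set N} := [set x | p x == x].
Definition leafset : {set N} := [set x | kids x == set0].

Definition acyclic : bool := [forall x, [exists y, (p y == y) && fconnect p x y]].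

Definition top x : N := odflt x [pick y | (p y == y) && fconnect p x y].

Definition height x : nat := (fingraph.order p x).-1.

Lemma rootsetP x : reflect (p x = x) (x \in rootset).
Proof. by rewrite inE; apply: eqP. Qed.

Lemma acyclicP : reflect (forall x, exists2 y, p y = y & fconnect p x y) acyclic.
Proof.
apply: (iffP forallP) => reach x; first by have /existsP[y /andP[/eqP]] := reach x; exists y.
by have [y py xy] := reach x; apply/existsP; exists y; rewrite py eqxx.
Qed.

Lemma fconnect_fix x y : p x = x -> fconnect p x y -> y = x.
Proof. by move=> px /fconnect_iterP[n <-]; rewrite iter_fix. Qed.

Lemma fconnect_total z x y :
  fconnect p z x -> fconnect p z y -> fconnect p x y || fconnect p y x.
Proof.
move=> /fconnect_iterP[n <-] /fconnect_iterP[m <-]; case: (leqP n m) => [nm|/ltnW nm].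
  by rewrite -(subnK nm) iterD fconnect_iter.
by rewrite -(subnK nm) iterD fconnect_iter orbT.
Qed.

Lemma height_fix x : p x = x -> height x = 0.
Proof.
move=> px; rewrite /height /fingraph.order (@eq_card _ _ (pred1 x)) ?card1 // => y.
rewrite !inE; apply/idP/eqP => [/(fconnect_fix px)//|->]; exact: connect0.
Qed.

Lemma sum_card_kids : \sum_x #|kids x| = #|N| - #|rootset|.
Proof.
have <- : #|~: rootset| = #|N| - #|rootset| by rewrite cardsCs setCK.
rewrite -sum1_card.
under eq_bigr => x _ do rewrite -sum1dep_card.
rewrite (exchange_big_dep (fun y => y \notin rootset)) /= => [|x y _]; last first.
  by rewrite inE => /andP[/eqP -> ]; rewrite eq_sym.
rewrite [RHS](eq_bigl (fun y => y \notin rootset)) => [|y]; last by rewrite !inE.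
apply: eq_bigr => y yr; rewrite (big_pred1 (p y)) // => x /=.
by rewrite eq_sym; case: eqP => // ->; move: yr; rewrite inE eq_sym.
Qed.

Lemma card_branching_forest :
  (forall x, #|kids x| != 1) -> #|N| + #|rootset| <= #|leafset|.*2.
Proof.
move=> branch; have rN : #|rootset| <= #|N| := max_card _.
have lN : #|leafset| + #|~: leafset| = #|N| by rewrite cardsC.
have : #|~: leafset|.*2 <= \sum_x #|kids x|.
  rewrite (bigID (mem leafset)) /= -[leqLHS]add0n leq_add //.
  rewrite -muln2 -sum1_card big_distrl /=.
  rewrite (eq_bigl (fun x => x \notin leafset)) => [|x]; last by rewrite !inE.
  apply: leq_sum => x; rewrite inE -cards_eq0.
  by have := branch x; case: #|_| => [|[|]].
rewrite sum_card_kids; lia.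
Qed.

Hypothesis p_acyclic : acyclic.

Lemma acyclic_ind (P : N -> Prop) :
    (forall x, p x = x -> P x) -> (forall x, p x <> x -> P (p x) -> P x) ->
  forall x, P x.
Proof.
move=> Pfix Pstep x; have [y py /fconnect_iterP[n xy]] := acyclicP p_acyclic x.
elim: n x xy => [x xy|n IHn x]; first by apply: Pfix; rewrite -[x]/(iter 0 p x) xy.
have [/Pfix //|/eqP px] := eqVneq (p x) x; rewrite iterSr => /IHn.
exact: Pstep.
Qed.

Lemma fconnect_anti x y : fconnect p x y -> fconnect p y x -> x = y.
Proof.
elim/acyclic_ind: x y => [x px y /(fconnect_fix px) ->//|x px IHx y].
rewrite fconnect_eqVf => /orP[/eqP //|pxy yx].
have pxx : fconnect p (p x) x := connect_trans pxy yx.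
by case: px; apply: IHx (fconnect1 _ _).
Qed.

Lemma fconnect_step x : p x <> x -> ~~ fconnect p (p x) x.
Proof.
move=> px; apply/negP=> h; apply: px; apply/esym.
by apply: fconnect_anti h; apply: fconnect1.
Qed.

Lemma topP x : p (top x) = top x /\ fconnect p x (top x).
Proof.
rewrite /top; case: pickP => [y /andP[/eqP]//|] /=.
by have [y py xy] := acyclicP p_acyclic x; move/(_ y); rewrite py eqxx xy.
Qed.

Lemma top_fix x : p (top x) = top x. Proof. by case: (topP x). Qed.

Lemma fconnect_top x : fconnect p x (top x). Proof. by case: (topP x). Qed.

Lemma top_unique x y : p y = y -> fconnect p x y -> top x = y.
Proof.
move=> py xy; have [pt xt] := topP x.
by case/orP: (fconnect_total xy xt) => /fconnect_fix -> //.
Qed.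

Lemma top_id x : p x = x -> top x = x.
Proof. by move=> px; apply: top_unique (connect0 _ _). Qed.

Lemma top_step x : top (p x) = top x.
Proof.
apply/esym/top_unique; first exact: top_fix.
exact: connect_trans (fconnect1 _ _) (fconnect_top _).
Qed.

Lemma height_step x : p x <> x -> height x = (height (p x)).+1.
Proof.
move=> px; rewrite /height /fingraph.order.
rewrite (@eq_card _ (fconnect p x) [predU1 x & fconnect p (p x)]) => [|y]; last first.
  by rewrite !inE [LHS]fconnect_eqVf eq_sym.
rewrite cardU1 inE fconnect_step //=.
by case E: #|_| => [|//]; have := card0_eq E (p x); rewrite inE connect0.
Qed.

Lemma findex_height x r : p r = r -> fconnect p x r -> findex p x r = height x.
Proof.
move=> pr; elim/acyclic_ind: x => [x px /(fconnect_fix px) ->|x px IH xr].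
  by rewrite findex0 height_fix.
have rx : r != x by apply/eqP=> rE; apply: px; rewrite -rE.
rewrite height_step // -IH; last first.
  by move: xr; rewrite fconnect_eqVf eq_sym (negbTE rx).
by have := fconnect_findex xr rx.
Qed.

Lemma height_lt x y : fconnect p y x -> y <> x -> height x < height y.
Proof.
elim/acyclic_ind: y => [y py /(fconnect_fix py) -> //|y py IH].
rewrite fconnect_eqVf (height_step py) => /orP[/eqP //|h _].
by case: (p y =P x) => [->//|/(IH h)/ltnW]; rewrite ltnS.
Qed.

Lemma exists_leaf_below x : exists2 z, z \in leafset & fconnect p z x.
Proof.
have xx : fconnect p x x by apply: connect0.
case: (arg_maxnP (P := fun z => fconnect p z x) height xx) => z zx z_max.
exists z => //; rewrite inE; apply/eqP/setP=> w; rewrite !inE.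
apply/negP=> /andP[/eqP wz /eqP zw].
have pw : p w <> w by rewrite wz => /esym.
have : height w <= height z by apply: z_max; apply: connect_trans zx; rewrite -wz fconnect1.
by rewrite (height_step pw) wz ltnn.
Qed.

Lemma fconnect_kid x y : fconnect p y x -> y <> x -> exists2 w, w \in kids x & fconnect p y w.
Proof.
elim/acyclic_ind: y => [y py /(fconnect_fix py) -> //|y py IH].
have [pyx|/eqP pyx] := eqVneq (p y) x => yx nyx.
  by exists y; rewrite ?inE ?pyx ?eqxx ?connect0 //; apply/eqP.
move: yx; rewrite fconnect_eqVf; case: eqP => //= _ /IH[] // w wx yw.
by exists w => //; apply: connect_trans yw; apply: fconnect1.
Qed.

Lemma kid_above_unique u v y y' :
    y \in kids v -> y' \in kids v -> fconnect p u y -> fconnect p u y' -> y = y'.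
Proof.
suff below z z' : z \in kids v -> z' \in kids v -> fconnect p z z' -> z = z'.
  by move=> yv yv' uy uy'; case/orP: (fconnect_total uy uy') => /below -> //.
rewrite !inE fconnect_eqVf => /andP[/eqP -> _] /andP[/eqP pz' z'v] /orP[/eqP //|vz'].
have zv' : fconnect p z' v by rewrite -pz' fconnect1.
by rewrite (fconnect_anti vz' zv') eqxx in z'v.
Qed.

Lemma fconnect_kid_above u v w z : w \in kids v -> fconnect p u w -> fconnect p u z ->
  fconnect p z v -> z <> v -> fconnect p z w.
Proof.
move=> wv uw uz zv zNv; have [w' wv' zw'] := fconnect_kid zv zNv.
by rewrite (kid_above_unique wv wv' uw (connect_trans uz zw')).
Qed.

End Forest.

Section EqForest.
Variables (N : finType) (p p' : N -> N).
Hypothesis eq_pp' : p =1 p'.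

Lemma eq_kids : kids p =1 kids p'.
Proof. by move=> x; apply/setP=> y; rewrite !inE eq_pp'. Qed.

Lemma eq_rootset : rootset p = rootset p'.
Proof. by apply/setP=> x; rewrite !inE eq_pp'. Qed.

Lemma eq_leafset : leafset p = leafset p'.
Proof. by apply/setP=> x; rewrite !inE eq_kids. Qed.

Lemma eq_acyclic : acyclic p = acyclic p'.
Proof.
by apply: eq_forallb => x; apply: eq_existsb => y; rewrite eq_pp' (eq_fconnect eq_pp').
Qed.

End EqForest.

Lemma imsetI_transport (T T' : finType) (h : T' -> T) (A B' : {set T'}) (B : {set T}) :
  {in A, forall x, (h x \in B) = (x \in B')} -> (h @: A) :&: B = h @: (A :&: B').
Proof.
move=> hB; apply/setP=> x; apply/setIP/imsetP => [[/imsetP[y yA ->]]|[y /setIP[yA yB] ->]].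
  by rewrite hB // => yB; exists y; rewrite // inE yA.
by rewrite imset_f // hB.
Qed.

Section ForestTransport.
Variables (N N' : finType) (h : N' -> N) (A : {set N'}) (p : N -> N) (p' : N' -> N').
Hypothesis h_inj : injective h.
Hypothesis p_closed : {in A, forall x, p' x \in A}.
Hypothesis h_par : {in A, forall x, p (h x) = h (p' x)}.

Lemma iter_transport n x : x \in A ->
  iter n p' x \in A /\ iter n p (h x) = h (iter n p' x).
Proof.
move=> xA; elim: n => //= n [nA ->]; split; first exact: p_closed.
by rewrite h_par.
Qed.

Lemma fconnect_transport x y : x \in A ->
  fconnect p (h x) (h y) = fconnect p' x y.
Proof.
move=> xA; apply/fconnect_iterP/fconnect_iterP=> -[n nE]; exists n.
  by apply: h_inj; rewrite -nE; case: (iter_transport n xA).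
by case: (iter_transport n xA) => _ ->; rewrite nE.
Qed.

Lemma height_transport x : x \in A -> height p (h x) = height p' x.
Proof.
move=> xA; rewrite /height /fingraph.order; congr _.-1.
rewrite -(card_image h_inj); apply: eq_card => y; rewrite !inE.
apply/idP/imageP => [/fconnect_iterP[n <-]|[z zx ->]].
  exists (iter n p' x); first by rewrite inE fconnect_iter.
  by case: (iter_transport n xA).
by rewrite fconnect_transport.
Qed.

Lemma rootset_transport : (h @: A) :&: rootset p = h @: (A :&: rootset p').
Proof. by apply: imsetI_transport => x xA; rewrite !inE h_par // (inj_eq h_inj). Qed.

Hypothesis h_kids : {in A, forall x, kids p (h x) = h @: kids p' x}.

Lemma leafset_transport : (h @: A) :&: leafset p = h @: (A :&: leafset p').
Proof. by apply: imsetI_transport => x xA; rewrite !inE h_kids // imset_eq0. Qed.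

End ForestTransport.

Lemma kids_transport (N N' : finType) (h : N' -> N) (p : N -> N) (p' : N' -> N') x :
    injective h -> (forall y, p (h y) = h (p' y)) ->
    (forall y, y \notin h @: setT -> p y = y) ->
  kids p (h x) = h @: kids p' x.
Proof.
move=> h_inj h_par p_out; apply/setP=> y; rewrite inE.
apply/andP/imsetP => [[/eqP py yx]|[z + ->]]; last first.
  by rewrite inE h_par !(inj_eq h_inj) => /andP.
have [/imsetP[z _ zE]|yout] := boolP (y \in h @: setT); last first.
  by rewrite -py p_out ?eqxx in yx.
exists z => //; rewrite inE; move: py yx.
by rewrite zE h_par (inj_eq h_inj) => /h_inj -> ->; rewrite eqxx.
Qed.

Section ForestAutomorphism.
Variable N : finType.
Implicit Types p a : N -> N.

Definition forest_aut p a : bool :=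
  [&& acyclic p, [forall x, #|kids p x| != 1], [forall x, a (p x) == p (a x)]
    & injectiveb a].

Lemma forest_autP p a :
  reflect [/\ acyclic p, forall x, #|kids p x| != 1, forall x, a (p x) = p (a x)
            & injective a] (forest_aut p a).
Proof.
apply: (iffP and4P) => -[p_acyclic branch a_comm a_inj]; split=> //.
- exact/forallP.
- by move=> x; apply/eqP; move: x; apply/forallP.
- exact/injectiveP.
- exact/forallP.
- by apply/forallP=> x; apply/eqP.
- exact/injectiveP.
Qed.

End ForestAutomorphism.

(** * Marked forests with an automorphism *)

(* Parent map, image map of the automorphism, and set of marked nodes. *)
Definition fstruct (N : finType) : finType :=
  ({ffun N -> N} * {ffun N -> N} * {set N})%type.

(* [Pointed]: a tree with one marked leaf.  [Stem o]: moreover, the automorphism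
   fixes the marked leaf, whose height is odd iff [b] when [o = Some b]. *)
Inductive kind := Void | Forest | Tree | Pointed | Stem of option bool.

Definition is_stem (K : kind) := if K is Stem _ then true else false.

Definition rooted (K : kind) :=
  match K with Void | Forest => false | Tree | Pointed | Stem _ => true end.

Definition pointed (K : kind) := match K with Pointed | Stem _ => true | _ => false end.

Section Structures.
Variable N : finType.
Implicit Types (A : {set N}) (s : fstruct N) (K : kind).

Definition fpar s : {ffun N -> N} := s.1.1.
Definition faut s : {ffun N -> N} := s.1.2.
Definition marks s : {set N} := s.2.

Definition supported A s : bool :=
  [forall x, if x \in A then (fpar s x \in A) && (faut s x \in A)
             else (fpar s x == x) && (faut s x == x)] && (marks s \subset A).

Definition anchored K s x : bool :=
  if K is Stem o then
    (faut s x == x) && (if o is Some b then odd (height (fpar s) x) == b else true)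
  else true.

Definition has_shape K A s : bool :=
  (rooted K ==> (#|A :&: rootset (fpar s)| == 1)) &&
  match K with
  | Void => A == set0
  | Forest | Tree => A :&: marks s == set0
  | Pointed | Stem _ =>
      [exists x in A :&: leafset (fpar s), (A :&: marks s == [set x]) && anchored K s x]
  end.

(* The marked leaf of a stem is not counted: gluing makes it an internal node. *)
Definition weight K A s : nat := #|A :&: leafset (fpar s)| - is_stem K.

Definition has_kind K A s : bool :=
  [&& supported A s, forest_aut (fpar s) (faut s) & has_shape K A s].

Lemma supportedP A s : reflect
  [/\ {in A, forall x, fpar s x \in A}, {in A, forall x, faut s x \in A},
      {in ~: A, fpar s =1 id}, {in ~: A, faut s =1 id} & marks s \subset A]
  (supported A s).
Proof.
apply: (iffP andP) => [[/forallP s_supp m_sub]|[p_in a_in p_out a_out m_sub]].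
  split=> // x; rewrite ?inE => xA; move: (s_supp x); rewrite ?xA ?(negbTE xA) => /andP[] //.
  - by move/eqP.
  - by move=> _ /eqP.
split=> //; apply/forallP=> x; case: ifP => xA; first by rewrite p_in ?a_in.
by rewrite p_out ?a_out ?eqxx // inE xA.
Qed.

Lemma has_shape_Tree A s :
  has_shape Tree A s = has_shape Forest A s && (#|A :&: rootset (fpar s)| == 1).
Proof. exact: andbC. Qed.

Lemma has_shape_pointed K A s : pointed K ->
  has_shape K A s = (#|A :&: rootset (fpar s)| == 1) &&
    [exists x in A :&: leafset (fpar s), (A :&: marks s == [set x]) && anchored K s x].
Proof. by case: K. Qed.

Lemma supported_setT s : supported setT s.
Proof. by rewrite /supported subsetT andbT; apply/forallP=> x; rewrite !inE. Qed.

Lemma fstruct_eq s s' :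
  fpar s =1 fpar s' -> faut s =1 faut s' -> marks s =i marks s' -> s = s'.
Proof.
case: s s' => [[p a] m] [[p' a'] m'] pp aa mm.
by congr (_, _, _); [apply/ffunP|apply/ffunP|apply/setP].
Qed.

End Structures.

Section ShapeTransport.
Variables (N N' : finType) (h : N' -> N) (A : {set N'}).
Variables (s : fstruct N) (s' : fstruct N').
Hypothesis h_inj : injective h.
Hypothesis p_closed : {in A, forall x, fpar s' x \in A}.
Hypothesis h_par : {in A, forall x, fpar s (h x) = h (fpar s' x)}.
Hypothesis h_aut : {in A, forall x, faut s (h x) = h (faut s' x)}.
Hypothesis h_marks : {in A, forall x, (h x \in marks s) = (x \in marks s')}.
Hypothesis h_kids : {in A, forall x, kids (fpar s) (h x) = h @: kids (fpar s') x}.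

Lemma anchored_transport K x : x \in A -> anchored K s (h x) = anchored K s' x.
Proof.
move=> xA; case: K => //= o; rewrite h_aut // (inj_eq h_inj).
by rewrite (height_transport h_inj p_closed h_par).
Qed.

Lemma has_shape_transport K : has_shape K (h @: A) s = has_shape K A s'.
Proof.
rewrite /has_shape (imsetI_transport h_marks) (rootset_transport h_inj h_par).
rewrite (leafset_transport h_kids) !imset_eq0 card_imset //.
have anchorE K' : [exists x in h @: (A :&: leafset (fpar s')),
      (h @: (A :&: marks s') == [set x]) && anchored K' s x] =
    [exists x in A :&: leafset (fpar s'), (A :&: marks s' == [set x]) && anchored K' s' x].
  apply/exists_inP/exists_inP => [[_ /imsetP[x xL ->]]|[x xL]].
    rewrite -imset_set1 (inj_eq (imset_inj h_inj)) anchored_transport => [xP|].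
      by exists x.
    by case/setIP: xL.
  move=> xP; exists (h x); first exact: imset_f.
  rewrite -imset_set1 (inj_eq (imset_inj h_inj)) anchored_transport //.
  by case/setIP: xL.
by case: K => // *; rewrite anchorE.
Qed.

Lemma weight_transport K : weight K (h @: A) s = weight K A s'.
Proof. by rewrite /weight (leafset_transport h_kids) card_imset. Qed.

End ShapeTransport.

(** * Transport along injections *)

Section Pushforward.
Variables (N N' : finType) (h : N' -> N).
Hypothesis h_inj : injective h.
Implicit Types (s : fstruct N') (f : N' -> N').

Definition extend f (y : N) : N := if [pick x | h x == y] is Some x then h (f x) else y.

Lemma extendE f x : extend f (h x) = h (f x).
Proof. by rewrite /extend; case: pickP => [z /eqP/h_inj ->|/(_ x)] //; rewrite eqxx. Qed.

Lemma extend_out f y : y \notin h @: setT -> extend f y = y.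
Proof.
by rewrite /extend; case: pickP => // x /eqP <-; rewrite imset_f.
Qed.

Lemma extend_inj f : injective f -> injective (extend f).
Proof.
move=> f_inj y y' E; have extend_in z : (extend f z \in h @: setT) = (z \in h @: setT).
  have [/imsetP[x _ ->]|zout] := boolP (z \in h @: setT); first by rewrite extendE imset_f.
  by rewrite extend_out // (negbTE zout).
have := extend_in y; rewrite E extend_in.
have [/imsetP[x _ yE]|yout] := boolP (y \in h @: setT); last first.
  by move/negbT=> yout'; move: E; rewrite !extend_out.
by case/imsetP=> x' _ yE'; move: E; rewrite yE yE' !extendE => /h_inj/f_inj ->.
Qed.

Definition pushforward s : fstruct N :=
  ([ffun y => extend (fpar s) y], [ffun y => extend (faut s) y], h @: marks s).

Lemma fpar_pushforward s x : fpar (pushforward s) (h x) = h (fpar s x).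
Proof. by rewrite ffunE extendE. Qed.

Lemma faut_pushforward s x : faut (pushforward s) (h x) = h (faut s x).
Proof. by rewrite ffunE extendE. Qed.

Lemma fpar_pushforward_out s y : y \notin h @: setT -> fpar (pushforward s) y = y.
Proof. by move=> yout; rewrite ffunE extend_out. Qed.

Lemma faut_pushforward_out s y : y \notin h @: setT -> faut (pushforward s) y = y.
Proof. by move=> yout; rewrite ffunE extend_out. Qed.

Lemma kids_pushforward s x : kids (fpar (pushforward s)) (h x) = h @: kids (fpar s) x.
Proof.
apply: kids_transport => // y; first exact: fpar_pushforward.
exact: fpar_pushforward_out.
Qed.

Lemma kids_pushforward_out s y :
  y \notin h @: setT -> kids (fpar (pushforward s)) y = set0.
Proof.
move=> yout; apply/setP=> z; rewrite !inE; apply/negP=> /andP[/eqP pz zy].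
have [/imsetP[x _ zE]|zout] := boolP (z \in h @: setT).
  by move: yout; rewrite -pz zE fpar_pushforward imset_f.
by rewrite -pz fpar_pushforward_out ?eqxx in zy.
Qed.

Lemma pushforward_inj : injective pushforward.
Proof.
move=> s s' E; apply: fstruct_eq => x.
- by apply: h_inj; rewrite -!fpar_pushforward E.
- by apply: h_inj; rewrite -!faut_pushforward E.
- by have /= mE := congr1 snd E; rewrite -(mem_imset _ _ h_inj) mE mem_imset.
Qed.

Lemma supported_pushforward s : supported (h @: setT) (pushforward s).
Proof.
apply/supportedP; split=> [_ /imsetP[x _ ->]|_ /imsetP[x _ ->]|y|y|].
- by rewrite fpar_pushforward imset_f.
- by rewrite faut_pushforward imset_f.
- by rewrite inE => /fpar_pushforward_out.
- by rewrite inE => /faut_pushforward_out.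
- exact/imsetS/subsetT.
Qed.

Lemma pushforward_surj (s : fstruct N) :
  supported (h @: setT) s -> exists s', pushforward s' = s.
Proof.
case/supportedP=> p_in a_in p_out a_out m_sub.
have lift_map (f : {ffun N -> N}) : {in h @: setT, forall y, f y \in h @: setT} ->
    exists g : {ffun N' -> N'}, forall x, h (g x) = f (h x).
  move=> f_in; have /fin_all_exists[g gE] x : exists y, h y = f (h x).
    by have /imsetP[y _ ->] := f_in (h x) (imset_f h (in_setT x)); exists y.
  by exists [ffun x => g x] => x; rewrite ffunE.
have [p' p'E] := lift_map _ p_in; have [a' a'E] := lift_map _ a_in.
exists (p', a', h @^-1: marks s); apply: fstruct_eq => y.
- have [/imsetP[x _ ->]|yout] := boolP (y \in h @: setT); first by rewrite fpar_pushforward.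
  by rewrite fpar_pushforward_out // p_out // inE.
- have [/imsetP[x _ ->]|yout] := boolP (y \in h @: setT); first by rewrite faut_pushforward.
  by rewrite faut_pushforward_out // a_out // inE.
apply/imsetP/idP => [[x + ->]|ym]; first by rewrite inE.
by have /imsetP[x _ yE] := subsetP m_sub y ym; exists x; rewrite // inE -yE.
Qed.

Lemma forest_aut_pushforward s :
  forest_aut (fpar (pushforward s)) (faut (pushforward s)) = forest_aut (fpar s) (faut s).
Proof.
have h_fconnect x y : fconnect (fpar (pushforward s)) (h x) (h y) = fconnect (fpar s) x y.
  by apply: (fconnect_transport (A := setT)) => // z _; apply: fpar_pushforward.
apply/forest_autP/forest_autP => -[/acyclicP reach branch a_comm a_inj]; split.
- apply/acyclicP=> x; have [y + /fconnect_iterP[n yE]] := reach (h x).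
  have [_ iterE] := iter_transport (h := h) (A := setT) (p := fpar (pushforward s))
    (p' := fpar s) (fun _ _ => in_setT _) (fun z _ => fpar_pushforward s z) n (in_setT x).
  rewrite -yE iterE fpar_pushforward => /h_inj py.
  by exists (iter n (fpar s) x); rewrite ?fconnect_iter.
- by move=> x; have := branch (h x); rewrite kids_pushforward card_imset.
- by move=> x; apply: h_inj; rewrite -faut_pushforward -!fpar_pushforward a_comm faut_pushforward.
- by move=> x y E; apply/h_inj/a_inj; rewrite !faut_pushforward E.
- apply/acyclicP=> y; have [/imsetP[x _ ->]|yout] := boolP (y \in h @: setT); last first.
    by exists y; rewrite ?connect0 // fpar_pushforward_out.
  by have [z pz xz] := reach x; exists (h z); rewrite ?h_fconnect // fpar_pushforward pz.
- move=> y; have [/imsetP[x _ ->]|yout] := boolP (y \in h @: setT).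
    by rewrite kids_pushforward card_imset.
  by rewrite kids_pushforward_out // cards0.
- move=> y; have [/imsetP[x _ ->]|yout] := boolP (y \in h @: setT).
    by rewrite fpar_pushforward !faut_pushforward fpar_pushforward a_comm.
  by rewrite fpar_pushforward_out // !faut_pushforward_out // fpar_pushforward_out.
- by move=> y y'; rewrite !ffunE; apply: extend_inj.
Qed.

End Pushforward.

Local Open Scope ring_scope.

Definition enumerator (N : finType) (K : kind) (A : {set N}) : {poly rat} :=
  \sum_(s : fstruct N | has_kind K A s) 'X^(weight K A s).

Definition exp_enumerator (K : kind) (m : nat) : {poly rat} :=
  (m`!%:R^-1 : rat) *: enumerator K [set: 'I_m].

Definition kind_count (N : finType) (K : kind) (n : nat) : nat :=
  #|[set s : fstruct N | has_kind K setT s & weight K setT s == n]|.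

Lemma coef_exp_enumerator K m n : (exp_enumerator K m)`_n = m`!%:R^-1 * (kind_count 'I_m K n)%:R.
Proof.
rewrite coefZ coef_sum /kind_count -sum1dep_card natr_sum [in RHS]big_mkcondr.
by congr (_ * _); apply: eq_bigr => s _; rewrite coefXn eq_sym; case: eqP.
Qed.

Lemma enumerator_pushforward (N N' : finType) (h : N' -> N) (K : kind) :
  injective h -> enumerator K (h @: [set: N']) = enumerator K [set: N'].
Proof.
move=> h_inj; rewrite /enumerator.
have shapeE s : has_shape K (h @: setT) (pushforward h s) = has_shape K setT s.
  apply: has_shape_transport => // x _; rewrite ?fpar_pushforward ?faut_pushforward //.
    by rewrite mem_imset.
  exact: kids_pushforward.
rewrite (eq_bigl (mem (pushforward h @: [set s | has_kind K setT s]))) => [|s].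
  rewrite big_imset /= => [|s s' _ _ /pushforward_inj]; last exact.
  apply: eq_big => s; first by rewrite inE.
  by move=> _; congr ('X^_); apply: weight_transport => // x _; apply: kids_pushforward.
rewrite inE; apply/and3P/imsetP => [[/pushforward_surj[//|s' <-]]|[s' + ->]].
  rewrite forest_aut_pushforward // shapeE => s_forest s_shape; exists s' => //.
  by rewrite inE /has_kind supported_setT s_forest.
rewrite inE => /and3P[_ s_forest s_shape]; rewrite forest_aut_pushforward // shapeE.
by split=> //; apply: supported_pushforward.
Qed.

Lemma enumeratorE (N : finType) (K : kind) (A : {set N}) :
  enumerator K A = (#|A|`!%:R : rat) *: exp_enumerator K #|A|.
Proof.
rewrite /exp_enumerator scalerA divff ?scale1r ?pnatr_eq0 -?lt0n ?fact_gt0 //.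
rewrite -(enumerator_pushforward K (@enum_val_inj _ (pred_of_set A))); congr enumerator.
apply/setP=> x; apply/idP/imsetP => [xA|[i _ ->]]; last exact: enum_valP.
by exists (enum_rank_in xA x); rewrite ?enum_rankK_in.
Qed.

Local Close Scope ring_scope.

(** * Products *)

Section Pieces.
Variables (N I : finType) (c : {ffun N -> I}).
Implicit Types (s : fstruct N) (i : I) (u : {ffun I -> fstruct N}).

Definition color_class i : {set N} := [set x | c x == i].

Definition compatible s : bool :=
  [forall x, (c (fpar s x) == c x) && (c (faut s x) == c x)].

Definition piece s i : fstruct N :=
  ([ffun x => if c x == i then fpar s x else x],
   [ffun x => if c x == i then faut s x else x], color_class i :&: marks s).

Definition assemble u : fstruct N :=
  ([ffun x => fpar (u (c x)) x], [ffun x => faut (u (c x)) x],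
   [set x | x \in marks (u (c x))]).

Lemma fpar_piece s x : fpar (piece s (c x)) x = fpar s x.
Proof. by rewrite ffunE eqxx. Qed.

Lemma faut_piece s x : faut (piece s (c x)) x = faut s x.
Proof. by rewrite ffunE eqxx. Qed.

Lemma pieceK s : assemble [ffun i => piece s i] = s.
Proof.
apply: fstruct_eq => x; first by rewrite ffunE ffunE fpar_piece.
  by rewrite ffunE ffunE faut_piece.
by rewrite inE ffunE !inE eqxx.
Qed.

Lemma assembleK u : (forall i, supported (color_class i) (u i)) ->
  [ffun i => piece (assemble u) i] = u.
Proof.
move=> u_supp; apply/ffunP=> i; rewrite ffunE; have /supportedP[_ _ p_out a_out m_sub] := u_supp i.
apply: fstruct_eq => x.
- by rewrite !ffunE; case: eqP => [->//|ci]; rewrite p_out // !inE; apply/eqP.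
- by rewrite !ffunE; case: eqP => [->//|ci]; rewrite a_out // !inE; apply/eqP.
rewrite !inE; case: eqP => [-> //|ci]; apply/esym/negP=> /(subsetP m_sub).
by rewrite inE => /eqP.
Qed.

Lemma supported_pieces s :
  [forall i, supported (color_class i) (piece s i)] = compatible s.
Proof.
apply/forallP/forallP => [s_supp x|c_compat i].
  have /supportedP[p_in a_in _ _ _] := s_supp (c x).
  have xA : x \in color_class (c x) by rewrite inE.
  by have := p_in x xA; have := a_in x xA; rewrite faut_piece fpar_piece !inE => -> ->.
apply/supportedP; split=> [x|x|x|x|]; rewrite ?inE ?ffunE; last exact: subsetIl.
- by move=> /eqP <-; rewrite eqxx; have /andP[] := c_compat x.
- by move=> /eqP <-; rewrite eqxx; have /andP[] := c_compat x.
- by move=> /negbTE ->.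
- by move=> /negbTE ->.
Qed.

Section Compatible.
Variable s : fstruct N.
Hypothesis c_compat : compatible s.

Lemma color_par x : c (fpar s x) = c x.
Proof. by have /forallP/(_ x)/andP[/eqP] := c_compat. Qed.

Lemma color_aut x : c (faut s x) = c x.
Proof. by have /forallP/(_ x)/andP[_ /eqP] := c_compat. Qed.

Lemma color_fconnect x y : fconnect (fpar s) x y -> c y = c x.
Proof.
move=> xy; apply/esym; apply: (fconnect_invariant _ xy) => z /=.
by rewrite color_par eqxx.
Qed.

Lemma kids_piece i x :
  kids (fpar (piece s i)) x = if c x == i then kids (fpar s) x else set0.
Proof.
apply/setP=> y; rewrite inE ffunE.
have [cx|cx] := eqVneq (c x) i; have [cy|cy] := eqVneq (c y) i; rewrite inE ?andbN //.
  apply/esym/negP=> /andP[/eqP py _].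
  by rewrite -color_par py cx eqxx in cy.
by apply/negP=> /andP[/eqP py _]; rewrite -py color_par cy eqxx in cx.
Qed.

Lemma fconnect_piece x y : fconnect (fpar (piece s (c x))) x y = fconnect (fpar s) x y.
Proof.
have cx : x \in color_class (c x) by rewrite inE.
apply: (fconnect_transport (h := id) (A := color_class (c x))) => // z; rewrite !inE.
  by rewrite color_par.
by move/eqP=> <-; rewrite fpar_piece.
Qed.

Lemma forest_aut_pieces :
  [forall i, forest_aut (fpar (piece s i)) (faut (piece s i))]
    = forest_aut (fpar s) (faut s).
Proof.
apply/forallP/forest_autP => [s_forest|[/acyclicP p_reach branch a_comm a_inj] i].
  split=> [|x|x|x y E].
  - apply/acyclicP=> x; have /forest_autP[/acyclicP/(_ x)[y py xy] _ _ _] := s_forest (c x).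
    rewrite fconnect_piece in xy; exists y => //.
    by rewrite -fpar_piece (color_fconnect xy).
  - by have /forest_autP[_ /(_ x) + _ _] := s_forest (c x); rewrite kids_piece eqxx.
  - have /forest_autP[_ _ /(_ x) + _] := s_forest (c x).
    rewrite fpar_piece faut_piece -{1}(color_par x) faut_piece.
    by rewrite -(color_aut x) fpar_piece.
  - have cxy : c x = c y by rewrite -color_aut E color_aut.
    have /forest_autP[_ _ _] := s_forest (c x); apply.
    by rewrite faut_piece cxy faut_piece.
apply/forest_autP; split=> [|x|x|x y].
- apply/acyclicP=> x; have [cx|cx] := eqVneq (c x) i; last first.
    by exists x; rewrite ?connect0 // ffunE (negbTE cx).
  have [y py xy] := p_reach x; exists y; last by rewrite -cx fconnect_piece.
  by rewrite -cx -(color_fconnect xy) fpar_piece.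
- by rewrite kids_piece; case: ifP => // _; rewrite cards0.
- rewrite !ffunE; have [cx|/negbTE cx] := eqVneq (c x) i; last by rewrite cx.
  by rewrite color_par color_aut cx eqxx a_comm.
- rewrite !ffunE; case: eqP => cx; case: eqP => cy //; first exact: a_inj.
    by move=> E; case: cy; rewrite -E color_aut.
  by move=> E; case: cx; rewrite E color_aut.
Qed.

Lemma kids_piece_class i :
  {in color_class i, forall x, kids (fpar (piece s i)) x = id @: kids (fpar s) x}.
Proof. by move=> x; rewrite inE kids_piece imset_id => ->. Qed.

Lemma has_shape_piece K i :
  has_shape K (color_class i) (piece s i) = has_shape K (color_class i) s.
Proof.
rewrite -{1}(imset_id (color_class i)).
have piece_in x : x \in color_class i -> c x = i by rewrite inE => /eqP.
apply: has_shape_transport => // [x|x|x|x|].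
- by move/piece_in <-; rewrite inE color_par.
- by move/piece_in <-; rewrite fpar_piece.
- by move/piece_in <-; rewrite faut_piece.
- by rewrite !inE => ->.
- exact: kids_piece_class.
Qed.

Lemma weight_piece K i : weight K (color_class i) (piece s i) = weight K (color_class i) s.
Proof.
by rewrite -{1}(imset_id (color_class i)); apply/weight_transport/kids_piece_class.
Qed.

End Compatible.

Definition good_coloring (K : I -> kind) s : bool :=
  [&& compatible s, forest_aut (fpar s) (faut s)
    & [forall i, has_shape (K i) (color_class i) s]].

Lemma good_coloringE (K : I -> kind) s :
  good_coloring K s = [forall i, has_kind (K i) (color_class i) (piece s i)].
Proof.
rewrite /good_coloring; have [c_compat|c_compat] := boolP (compatible s) => /=; last first.
  apply/esym/negP=> /forallP sK; case/negP: c_compat; rewrite -supported_pieces.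
  by apply/forallP=> i; have /and3P[] := sK i.
rewrite -(forest_aut_pieces c_compat).
have := c_compat; rewrite -supported_pieces => /forallP s_supp.
apply/andP/forallP => [[/forallP s_forest /forallP s_shape] i|sK].
  by rewrite /has_kind s_supp s_forest (has_shape_piece c_compat) s_shape.
split; apply/forallP=> i; have /and3P[_ fi] := sK i => //.
by rewrite (has_shape_piece c_compat).
Qed.

Local Open Scope ring_scope.

Lemma prod_enumerator (K : I -> kind) :
  \prod_i enumerator (K i) (color_class i) =
  \sum_(s | good_coloring K s) 'X^(\sum_i weight (K i) (color_class i) s).
Proof.
rewrite /enumerator bigA_distr_big_dep /=.
rewrite (reindex_onto (fun s => [ffun i => piece s i]) assemble) => [|u uK]; last first.
  by apply: assembleK => i; have /and3P[] := familyP uK i.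
apply: eq_big => s.
  rewrite pieceK eqxx andbT good_coloringE; apply/familyP/forallP => sK i.
    by have := sK i; rewrite ffunE.
  by rewrite ffunE; apply: sK.
case/andP=> /familyP sK _; rewrite -prodrXr; apply: eq_bigr => i _; rewrite ffunE.
have c_compat : compatible s.
  by rewrite -supported_pieces; apply/forallP=> j; have := sK j; rewrite ffunE => /and3P[].
by rewrite (weight_piece c_compat).
Qed.

End Pieces.

(** * Generating functions *)

Lemma card_weight_bound (N : finType) (K : kind) (s : fstruct N) :
  has_kind K setT s -> #|N| <= (weight K setT s).*2 + 2.
Proof.
case/and3P=> _ /forest_autP[_ /card_branching_forest + _ _] _.
by rewrite /weight setTI; case: (is_stem K); lia.
Qed.

Local Open Scope ring_scope.

Lemma coef_exp_enumerator_eq0 K m n : (n.*2 + 3 <= m)%N -> (exp_enumerator K m)`_n = 0.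
Proof.
move=> nm; rewrite coef_exp_enumerator (_ : kind_count _ _ _ = 0%N) ?mulr0 //.
apply: eq_card0 => s.
rewrite inE; apply/negP=> /andP[/card_weight_bound + /eqP wn].
by rewrite card_ord wn; lia.
Qed.

(* The sum is finite because a forest of weight [n] has at most [2 n + 2] nodes. *)
Definition series (K : kind) : fps := fun n => \sum_(m < n.*2 + 3) (exp_enumerator K m)`_n.

Lemma seriesE K n M : (n.*2 + 3 <= M)%N -> series K n = \sum_(m < M) (exp_enumerator K m)`_n.
Proof.
move=> nM; apply: esym.
apply: (big_ord_widen_idx _ (F := fun m => (exp_enumerator K m)`_n)) => // m.
exact: coef_exp_enumerator_eq0.
Qed.

Definition agree (n : nat) (f : fps) (q : {poly rat}) := forall e, (e <= n)%N -> f e = q`_e.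

Lemma agree_series K n M : (n.*2 + 3 <= M)%N ->
  agree n (series K) (\sum_(m < M) exp_enumerator K m).
Proof. by move=> nM e en; rewrite coef_sum (@seriesE _ _ M) //; lia. Qed.

Section Agree.
Variable n : nat.

Lemma agree_const c : agree n (fps_const c) c%:P.
Proof. by move=> e _; rewrite coefC. Qed.

Lemma agree_mul f g q r : agree n f q -> agree n g r -> agree n (fps_mul f g) (q * r).
Proof.
move=> fq gr e en; rewrite coefM; apply: eq_bigr => i _.
rewrite fq ?gr // (leq_trans _ en) ?leq_subr // -ltnS; exact: ltn_ord.
Qed.

Lemma agree_exp f q k : agree n f q -> agree n (fps_exp f k) (q ^+ k).
Proof.
move=> fq; elim: k => [|k IHk]; first by rewrite expr0 -polyC1; apply: agree_const.
by rewrite exprS; apply: agree_mul.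
Qed.

Lemma agree_ext f g q : f =1 g -> agree n f q -> agree n g q.
Proof. by move=> fg fq e en; rewrite -fg fq. Qed.

End Agree.

Section ConeSupported.
Variable R : comNzRingType.
Implicit Types P Q : {poly {poly R}}.

Definition cone_supported (C : nat) P :=
  forall m n, (n.*2 + C < m)%N -> P`_m`_n = 0.

Lemma cone_supportedM C D P Q :
  cone_supported C P -> cone_supported D Q -> cone_supported (C + D) (P * Q).
Proof.
move=> P_cone Q_cone m n nm; rewrite coefM coef_sum big1 // => i _; rewrite coefM big1 // => j _.
have im : (i <= m)%N by rewrite -ltnS.
have jn : (j <= n)%N by rewrite -ltnS.
have [ji|ij] := ltnP (j.*2 + C) i; first by rewrite P_cone // mul0r.
rewrite Q_cone ?mulr0 //; lia.
Qed.

Lemma cone_supported_prod (I : finType) (P : I -> {poly {poly R}}) C :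
  (forall i, cone_supported C (P i)) -> cone_supported (#|I| * C) (\prod_i P i).
Proof.
move=> P_cone; rewrite -big_enum cardE /=; elim: (enum I) => [|i r IHr].
  rewrite big_nil => m n; rewrite coef1; case: m => // m _; exact: coef0.
by rewrite big_cons /= mulSn; apply: cone_supportedM.
Qed.

Lemma cone_supported_horner1 C P n M :
  cone_supported C P -> (n.*2 + C < M)%N -> P.[1]`_n = \sum_(m < M) P`_m`_n.
Proof.
move=> P_cone nM; rewrite (horner_coef_wide _ (leq_maxr M _)) coef_sum.
under eq_bigr => m _ do rewrite expr1n mulr1.
apply: (big_ord_widen_idx _ (F := fun m => P`_m`_n)); first exact: leq_maxl.
by move=> m Mm; apply: P_cone; lia.
Qed.

End ConeSupported.

Lemma sum_enumerator_colorings (I : finType) (K : I -> kind) n M :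
    (n.*2 + (#|I| * 2 + 3) <= M)%N ->
  \sum_(m < M) (m`!%:R^-1 *
    (\sum_(c : {ffun 'I_m -> I}) \prod_i enumerator (K i) (color_class c i))`_n)
  = (\prod_i \sum_(m < M) exp_enumerator (K i) m)`_n.
Proof.
move=> nM; pose P i : {poly {poly rat}} := \poly_(m < M) exp_enumerator (K i) m.
have horner1E i : \sum_(m < M) exp_enumerator (K i) m = (P i).[1].
  by rewrite horner_poly; apply: eq_bigr => m _; rewrite expr1n mulr1.
rewrite (eq_bigr _ (fun i _ => horner1E i)) -horner_prod.
have P_cone : cone_supported (#|I| * 2) (\prod_i P i).
  apply: cone_supported_prod => i m e em; rewrite coef_poly.
  case: ifP => _; last exact: coef0.
  by apply: coef_exp_enumerator_eq0; rewrite addnS.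
rewrite (cone_supported_horner1 P_cone (M := M)); last by lia.
apply: eq_bigr => m _.
under [in LHS]eq_bigr => c _ do under eq_bigr => i _ do rewrite enumeratorE.
rewrite (sum_colorings (f := fun i j => j`!%:R *: exp_enumerator (K i) j) (P := P)) => [|i j jm].
  by rewrite coefMn -[X in _ * X]mulr_natl mulrA mulVf ?mul1r // pnatr_eq0 -lt0n fact_gt0.
by rewrite coef_poly (leq_ltn_trans jm (ltn_ord m)) scaler_nat.
Qed.

Local Close Scope ring_scope.

(** * Removing the root of a tree *)

Section RootRemoval.
Variables (N : finType) (r : N).
Implicit Types s : fstruct N.
Notation A := (~: [set r]).

Definition graft s : fstruct N :=
  ([ffun x => if fpar s x == x then r else fpar s x], faut s, marks s).

Definition prune s : fstruct N :=
  ([ffun x => if fpar s x == r then x else fpar s x], faut s, marks s).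

Section Graft.
Variable s : fstruct N.
Hypothesis s_supp : supported A s.

Lemma fpar_eq_removed x : (fpar s x == r) = (x == r).
Proof.
have /supportedP[p_in _ p_out _ _] := s_supp; apply/idP/eqP => [pr|->]; last first.
  by rewrite p_out ?eqxx // !inE eqxx.
by apply/eqP; apply: contraTT pr => xr; have := p_in x; rewrite !inE; apply.
Qed.

Lemma faut_removed : faut s r = r.
Proof. by have /supportedP[_ _ _ a_out _] := s_supp; rewrite a_out // !inE eqxx. Qed.

Lemma fpar_removed : fpar s r = r. Proof. by apply/eqP; rewrite fpar_eq_removed. Qed.

Lemma fpar_graft x : fpar (graft s) x = if fpar s x == x then r else fpar s x.
Proof. by rewrite ffunE. Qed.

Lemma fpar_graft_eq_root x : (fpar (graft s) x == r) = (fpar s x == x).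
Proof.
rewrite fpar_graft; have [_|px] := eqVneq (fpar s x) x; first by rewrite eqxx.
by apply: contraNF px => /[!fpar_eq_removed]/eqP ->; rewrite fpar_removed.
Qed.

Lemma graftK : prune (graft s) = s.
Proof.
apply: fstruct_eq => // x; rewrite ffunE fpar_graft_eq_root fpar_graft.
by case: eqP.
Qed.

Lemma rootset_graft : rootset (fpar (graft s)) = [set r].
Proof.
apply/setP=> x; rewrite !inE fpar_graft; case: (fpar s x =P x) => [_|/eqP px].
  by rewrite eq_sym.
by rewrite (negbTE px); apply/esym; apply: contraNF px => /eqP ->; rewrite fpar_removed.
Qed.

Lemma kids_graft_root : kids (fpar (graft s)) r = A :&: rootset (fpar s).
Proof. by apply/setP=> x; rewrite !inE fpar_graft_eq_root andbC. Qed.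

Lemma kids_graft x : x != r -> kids (fpar (graft s)) x = kids (fpar s) x.
Proof.
move=> xr; apply/setP=> y; rewrite !inE fpar_graft; case: (fpar s y =P y) => [->|//].
by rewrite eq_sym (negbTE xr) andbN.
Qed.

Lemma leafset_graft :
  A :&: rootset (fpar s) != set0 -> leafset (fpar (graft s)) = A :&: leafset (fpar s).
Proof.
move=> some_root; apply/setP=> x; rewrite !inE; have [->|xr] := eqVneq x r.
  by rewrite kids_graft_root (negbTE some_root).
by rewrite kids_graft.
Qed.

Lemma removed_rootset_neq0 :
  A != set0 -> acyclic (fpar s) -> A :&: rootset (fpar s) != set0.
Proof.
case/set0Pn=> x xA /acyclicP/(_ x)[y py xy]; apply/set0Pn; exists y.
have same_root : (x == r) = (y == r).
  apply: (fconnect_invariant _ xy (k := fun z => z == r)) => z /=.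
  by rewrite fpar_eq_removed eqxx.
by move: xA; rewrite !inE py eqxx same_root andbT.
Qed.

Lemma acyclic_graft : acyclic (fpar (graft s)) = acyclic (fpar s).
Proof.
apply/idP/idP => p_acyclic; apply/acyclicP=> x; elim/(acyclic_ind p_acyclic): x => x.
- move/rootsetP; rewrite rootset_graft => /set1P ->.
  by exists r; rewrite ?connect0 // fpar_removed.
- have [px _ _|px _] := eqVneq (fpar s x) x; first by exists x; rewrite ?connect0.
  rewrite fpar_graft (negbTE px) => -[y py xy]; exists y => //.
  exact: connect_trans (fconnect1 _ _) xy.
- move/eqP=> px; exists r; last by rewrite -(eqP (etrans (fpar_graft_eq_root x) px)) fconnect1.
  by rewrite fpar_graft fpar_removed eqxx.
- move/eqP/negbTE=> px [y py xy]; exists y => //; apply: connect_trans xy.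
  by rewrite -[fpar s x](_ : fpar (graft s) x = _) ?fconnect1 // fpar_graft px.
Qed.

Lemma faut_graft_comm : injective (faut s) ->
  (forall x, faut s (fpar (graft s) x) = fpar (graft s) (faut s x)) <->
  (forall x, faut s (fpar s x) = fpar s (faut s x)).
Proof.
move=> a_inj; have aroot := faut_removed.
split=> a_comm x; have := a_comm x; rewrite !fpar_graft.
  case: (fpar s x =P x) => [px|px]; case: (fpar s (faut s x) =P faut s x) => [pax|pax] //.
  - by rewrite px pax.
  - rewrite aroot => /esym/eqP; rewrite fpar_eq_removed => /eqP ax.
    by case: pax; rewrite ax fpar_removed.
  - rewrite -aroot => /a_inj/eqP; rewrite fpar_eq_removed => /eqP xr.
    by case: px; rewrite xr fpar_removed.
by move=> <-; rewrite (inj_eq a_inj); case: eqP.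
Qed.

Lemma forest_aut_graft : forest_aut (fpar (graft s)) (faut (graft s)) =
  forest_aut (fpar s) (faut s) && (#|A :&: rootset (fpar s)| != 1).
Proof.
have kids_root : kids (fpar s) r = set0.
  by apply/setP=> x; rewrite !inE fpar_eq_removed andbN.
apply/forest_autP/andP => [[p_acyclic branch a_comm a_inj]|[+ not_one_root]].
  split; last by rewrite -kids_graft_root.
  apply/forest_autP; split=> //; first by rewrite -acyclic_graft.
    move=> x; have [->|xr] := eqVneq x r; first by rewrite kids_root cards0.
    by rewrite -kids_graft.
  exact/faut_graft_comm.
case/forest_autP=> p_acyclic branch a_comm a_inj; split=> //; first by rewrite acyclic_graft.
  move=> x; have [->|xr] := eqVneq x r; first by rewrite kids_graft_root.
  by rewrite kids_graft.
exact/(faut_graft_comm a_inj).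
Qed.

Lemma has_kind_graft : has_kind Tree setT (graft s) =
  has_kind Forest A s && (#|A :&: rootset (fpar s)| != 1).
Proof.
have /supportedP[_ _ _ _ /setIidPr m_sub] := s_supp.
rewrite /has_kind supported_setT s_supp forest_aut_graft has_shape_Tree setTI rootset_graft.
by rewrite cards1 /has_shape /= setTI m_sub andbT andbAC.
Qed.

End Graft.

Section Prune.
Variable s : fstruct N.
Hypotheses (s_tree : has_kind Tree setT s) (sr : fpar s r = r).

Lemma fpar_fix_root x : (fpar s x == x) = (x == r).
Proof.
have /and3P[_ _ /andP[/cards1P[r' rootE] _]] := s_tree; rewrite setTI in rootE.
have rr' : r = r' by apply/set1P; rewrite -rootE; apply/rootsetP.
by rewrite -[RHS]in_set1 rr' -rootE inE.
Qed.

Lemma faut_eq_root x : (faut s x == r) = (x == r).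
Proof.
have /and3P[_ /forest_autP[_ _ a_comm a_inj] _] := s_tree.
by rewrite -!fpar_fix_root -a_comm (inj_eq a_inj).
Qed.

Lemma supported_prune : supported A (prune s).
Proof.
apply/supportedP; split=> [x|x|x|x|]; rewrite ?inE ?ffunE.
- by move=> xr; case: (fpar s x =P r) => [//|/eqP].
- by rewrite faut_eq_root.
- by move/negbNE/eqP ->; rewrite sr eqxx.
- by move/negbNE/eqP ->; apply/eqP; rewrite faut_eq_root.
- have /and3P[_ _ /andP[_]] := s_tree; rewrite setTI -[marks (prune s)]/(marks s) => /eqP ->.
  exact: sub0set.
Qed.

Lemma pruneK : graft (prune s) = s.
Proof.
apply: fstruct_eq => // x; rewrite !ffunE; case: (fpar s x =P r) => [->|px].
  by rewrite eqxx.
by case: ifP => //; rewrite fpar_fix_root => /eqP xr; case: px; rewrite xr sr.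
Qed.

End Prune.

Local Open Scope ring_scope.

Lemma planted_trees_enumerator : (1 < #|N|)%N ->
  \sum_(s : fstruct N | has_kind Tree setT s && (fpar s r == r)) 'X^(weight Tree setT s)
  = enumerator Forest A - enumerator Tree A.
Proof.
move=> N_gt1; pose S := [set s | has_kind Forest A s & #|A :&: rootset (fpar s)| != 1%N].
have A_neq0 : A != set0 by rewrite -card_gt0 cardsC1; case: #|N| N_gt1 => [|[]].
have -> : enumerator Forest A - enumerator Tree A = \sum_(s in S) 'X^(weight Tree A s).
  rewrite /enumerator [X in X - _](bigID (fun s => #|A :&: rootset (fpar s)| == 1%N)) /=.
  rewrite [X in X + _ - _](eq_bigl (has_kind Tree A)) => [|s].
    by rewrite addrAC subrr add0r; apply: eq_bigl => s; rewrite inE.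
  by rewrite /has_kind has_shape_Tree !andbA.
rewrite (eq_bigl (mem (graft @: S))) => [|s]; last first.
  rewrite inE; apply/andP/imsetP => [[s_tree /eqP sr]|[s' + ->]].
    exists (prune s); last by rewrite pruneK.
    by rewrite inE -(has_kind_graft (supported_prune s_tree sr)) pruneK.
  rewrite inE => /andP[/[dup] s'F /and3P[s_supp _ _] not_one_root].
  rewrite has_kind_graft // s'F not_one_root; split=> //; apply/eqP/rootsetP.
  by rewrite rootset_graft ?set11.
rewrite big_imset /= => [|s s']; last first.
  rewrite !inE => /andP[/and3P[s_supp _ _] _] /andP[/and3P[s_supp' _ _] _] E.
  by rewrite -(graftK s_supp) E graftK.
apply: eq_bigr => s; rewrite inE => /andP[/and3P[s_supp /forest_autP[p_acyclic _ _ _] _] _].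
by rewrite /weight setTI leafset_graft ?removed_rootset_neq0.
Qed.

End RootRemoval.

Local Open Scope ring_scope.

Lemma exp_enumerator_forest m :
  exp_enumerator Forest m.+1 = exp_enumerator Tree m.+1 + exp_enumerator Tree m.+2.
Proof.
have fact_neq0 : m.+2`!%:R != 0 :> rat by rewrite pnatr_eq0 -lt0n fact_gt0.
pose grafted := exp_enumerator Forest m.+1 - exp_enumerator Tree m.+1.
suff enumerator_tree : enumerator Tree [set: 'I_m.+2] = (m.+2`!%:R : rat) *: grafted.
  rewrite [exp_enumerator Tree m.+2]/exp_enumerator enumerator_tree scalerA mulVf //.
  by rewrite scale1r subrKC.
have -> : enumerator Tree [set: 'I_m.+2] = \sum_(r : 'I_m.+2) \sum_(s : fstruct 'I_m.+2 |
    has_kind Tree setT s && (fpar s r == r)) 'X^(weight Tree setT s).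
  rewrite (exchange_big_dep (has_kind Tree setT)) /= => [|r s _ /andP[] //].
  apply: eq_bigr => s s_tree; rewrite s_tree /= sumr_const.
  have /and3P[_ _ /andP[+ _]] := s_tree; rewrite setTI => /eqP root1.
  by rewrite (_ : #|_| = 1%N) // -root1; apply: eq_card => r; rewrite !inE.
rewrite (eq_bigr (fun _ => (m.+1`!%:R : rat) *: grafted)).
  by rewrite sumr_const card_ord -scaler_nat [in RHS]factS natrM -scalerA.
move=> r _; rewrite planted_trees_enumerator ?card_ord // !enumeratorE cardsC1 card_ord /=.
by rewrite scalerBr.
Qed.

Lemma exp_enumerator0 K : exp_enumerator K 0 = (~~ rooted K)%:R.
Proof.
rewrite /exp_enumerator /enumerator fact0 invr1 scale1r; case: (boolP (rooted K)) => rK /=.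
  rewrite big_pred0 // => s; apply/negP=> /and3P[_ _ /andP[]].
  by rewrite rK setTI (_ : #|_| = 0%N) //; apply: eq_card0 => -[].
rewrite (big_pred1 ([ffun x => x], [ffun x => x], set0)) => [|s].
  by rewrite /weight setTI (_ : #|_| = 0%N) ?expr0 //; apply: eq_card0 => -[].
have -> : s = ([ffun x => x], [ffun x => x], set0) by apply: fstruct_eq => -[].
rewrite /= eqxx /has_kind supported_setT andTb; apply/andP; split.
  by apply/forest_autP; split=> [|[]|[]|[]] //; apply/acyclicP=> -[].
have no_point : [set: 'I_0] = set0 by apply/setP=> -[].
by rewrite /has_shape (negbTE rK); case: (K) rK => //= _; rewrite ?no_point ?set0I eqxx.
Qed.

Lemma exp_enumerator_tree1 : exp_enumerator Tree 1 = 'X.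
Proof.
have par1 (s : fstruct 'I_1) : fpar s =1 id by move=> x; rewrite (ord1 x) (ord1 (fpar s _)).
have rootsT (s : fstruct 'I_1) : rootset (fpar s) = setT.
  by apply/setP=> x; rewrite !inE par1 eqxx.
have kids0 (s : fstruct 'I_1) x : kids (fpar s) x = set0.
  by apply/setP=> y; rewrite !inE par1 andbN.
rewrite /exp_enumerator /enumerator invr1 scale1r.
rewrite (big_pred1 ([ffun x => x], [ffun x => x], set0)).
  rewrite /weight setTI (_ : leafset _ = setT) ?cardsT ?card_ord //.
  by apply/setP=> x; rewrite !inE kids0 eqxx.
move=> s; apply/idP/eqP => [/and3P[_ _ /andP[_]]|->].
  rewrite setTI => /eqP no_marks.
  apply: fstruct_eq => x; rewrite ?ffunE ?par1 ?no_marks //.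
  by rewrite (ord1 x) (ord1 (faut s _)).
apply/and3P; split; first exact: supported_setT.
  apply/forest_autP; split=> [|x|x|x y _].
  - by apply/acyclicP=> x; exists x; rewrite ?par1.
  - by rewrite kids0 cards0.
  - by rewrite !par1.
  - by rewrite (ord1 x) (ord1 y).
by rewrite /has_shape /= !setTI rootsT cardsT card_ord /marks /= !eqxx.
Qed.

Lemma series_forest n :
  series Forest n = 2 * series Tree n + (n == 0)%:R - (n == 1)%:R.
Proof.
set M := (n.*2 + 3)%N.
have shift1 : series Tree n = \sum_(m < M) (exp_enumerator Tree m.+1)`_n.
  by rewrite (@seriesE _ _ M.+1) // big_ord_recl exp_enumerator0 coef0 add0r.
have shift2 : series Tree n = (n == 1)%:R + \sum_(m < M) (exp_enumerator Tree m.+2)`_n.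
  rewrite (@seriesE _ _ M.+2) ?leqW // big_ord_recl exp_enumerator0 coef0 add0r.
  by rewrite big_ord_recl exp_enumerator_tree1 coefX.
have -> : series Forest n = (n == 0)%:R +
    \sum_(m < M) ((exp_enumerator Tree m.+1)`_n + (exp_enumerator Tree m.+2)`_n).
  rewrite (@seriesE _ _ M.+1) // big_ord_recl exp_enumerator0 coef1; congr (_ + _).
  by apply: eq_bigr => m _; rewrite -coefD -exp_enumerator_forest.
rewrite big_split /= -shift1 mulrDl mul1r [X in _ = _ + X + _ - _]shift2; ring.
Qed.

Lemma sum_exp_enumerator_void M : (0 < M)%N -> \sum_(m < M) exp_enumerator Void m = 1.
Proof.
case: M => // M _; rewrite big_ord_recl exp_enumerator0 big1 ?addr0 // => m _.
rewrite /exp_enumerator /enumerator big_pred0 ?scaler0 // => s.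
apply/negP=> /and3P[_ _ /andP[_]].
by rewrite -cards_eq0 cardsT card_ord.
Qed.

Local Close Scope ring_scope.

(** * Leaf-labeled trees *)

Section Ltree.
Variables (n : nat) (N : finType) (t : ltree n N).

Lemma children_kids : rootset (par t) = [set troot t] -> children t =1 kids (par t).
Proof.
move=> rootE x; apply/setP=> y; rewrite !inE /child andbC; apply: andb_id2l => /eqP <-.
by rewrite -[y == troot t]in_set1 -rootE inE eq_sym.
Qed.

Lemma leaf_leafset : rootset (par t) = [set troot t] -> leaf t =i leafset (par t).
Proof. by move=> rootE x; rewrite inE -children_kids. Qed.

Lemma is_ltreeP : reflect
  [/\ acyclic (par t), rootset (par t) = [set troot t],
      forall x, #|kids (par t) x| != 1 & lab t \in labelings n (leafset (par t))]
  (is_ltree t).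
Proof.
pose single_root := rootset (par t) = [set troot t].
have leafE (rootE : single_root) x : leaf t x = (x \in leafset (par t)).
  exact: leaf_leafset.
have branchE (rootE : single_root) x :
    leaf t x || (2 <= #|children t x|) = (#|kids (par t) x| != 1).
  by rewrite leafE // inE children_kids // -cards_eq0; case: #|_| => [|[|]].
apply: (iffP and5P) => [[/eqP par_r /forallP anc_r /forallP branch + /forallP labE]|].
  move/injectiveP=> l_inj.
  have rootE : single_root.
    apply/setP=> x; apply/rootsetP/set1P => [px|->//].
    exact/esym/(fconnect_fix px)/anc_r.
  split=> [|//|x|].
  - by apply/acyclicP=> x; exists (troot t); last exact: anc_r.
  - by rewrite -branchE.
  - by apply/labelingsP; split=> // x; rewrite -leafE // (eqP (labE x)).
case=> p_acyclic rootE branch /labelingsP[l_inj labE]; split; last 1 first.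
- by apply/forallP=> x; rewrite leafE // labE.
- by apply/eqP/rootsetP; rewrite rootE set11.
- apply/forallP=> x; have [/rootsetP + xt] := topP p_acyclic x.
  by rewrite rootE => /set1P <-.
- by apply/forallP=> x; rewrite branchE.
- exact/injectiveP.
Qed.

Hypothesis t_tree : is_ltree t.

Lemma ltree_acyclic : acyclic (par t). Proof. by case/is_ltreeP: t_tree. Qed.

Lemma ltree_branching x : #|kids (par t) x| != 1. Proof. by case/is_ltreeP: t_tree. Qed.

Lemma lab_labelings : lab t \in labelings n (leafset (par t)).
Proof. by case/is_ltreeP: t_tree. Qed.

Lemma lab_inj : injective (lab t). Proof. by case/labelingsP: lab_labelings. Qed.

Lemma rootset_ltree : rootset (par t) = [set troot t].
Proof. by case/is_ltreeP: t_tree. Qed.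

Lemma par_fix x : (par t x == x) = (x == troot t).
Proof. by rewrite -[RHS]in_set1 -rootset_ltree inE. Qed.

Lemma par_root : par t (troot t) = troot t.
Proof. by apply/eqP; rewrite par_fix. Qed.

Lemma anc_root x : anc t (troot t) x.
Proof. by case/and5P: t_tree => _ /forallP. Qed.

Lemma childrenE x : children t x = kids (par t) x.
Proof. exact: children_kids rootset_ltree x. Qed.

Lemma mem_kids_par x : x != troot t -> x \in kids (par t) (par t x).
Proof. by move=> xr; rewrite inE eqxx eq_sym par_fix. Qed.

Lemma leafE x : leaf t x = (x \in leafset (par t)).
Proof. exact: leaf_leafset rootset_ltree x. Qed.

Lemma leaf_codom x : leaf t x = (x \in codom (lab t)).
Proof. by rewrite leafE; have /labelingsP[_ ->] := lab_labelings. Qed.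

Lemma leaf_lab i : leaf t (lab t i).
Proof. by rewrite leaf_codom codom_f. Qed.

Lemma internal_par x : x != troot t -> ~~ leaf t (par t x).
Proof. by move=> xr; apply/set0Pn; exists x; rewrite inE /child xr eqxx. Qed.

Lemma leaf_minimal x y : leaf t x -> anc t x y -> y = x.
Proof.
move=> lx xy; apply/eqP/negPn/negP=> /eqP yx.
have [w wx _] := fconnect_kid ltree_acyclic xy yx.
by move: lx; rewrite leafE inE => /eqP x0; rewrite x0 inE in wx.
Qed.

Lemma exists_label_below x : exists i, anc t x (lab t i).
Proof.
have [z zl zx] := exists_leaf_below ltree_acyclic x.
by move: zl zx; rewrite -leafE leaf_codom => /codomP[i ->]; exists i.
Qed.

Lemma depth_height x : depth t x = height (par t) x.
Proof. exact: (findex_height ltree_acyclic par_root (anc_root x)). Qed.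

(* A permutation preserving adjacency could only reverse the edge above [x]
   by identifying [x] with its grandparent, which injectivity forbids. *)
Lemma is_autP (a : {perm N}) :
  reflect (forall x, a (par t x) = par t (a x)) (is_aut t a).
Proof.
have adjE x y : adj t x y = (x != y) && ((par t y == x) || (par t x == y)).
  rewrite /adj /child -!par_fix.
  have [->|xy] := eqVneq x y; first by rewrite !andNb.
  congr (_ || _); first by case: (par t y =P x) => [->|]; rewrite ?andbF ?andbT.
  by case: (par t x =P y) => [->|]; rewrite ?andbF ?andbT // eq_sym.
apply: (iffP andP) => [[/forallP aP /eqP ar] x|aP].
  elim/(acyclic_ind ltree_acyclic): x => [x px|x px IH].
    have /eqP -> : x == troot t by rewrite -par_fix px.
    by rewrite par_root ar par_root.
  have /forallP/(_ (par t x)) := aP x; rewrite !adjE eqxx orbT andbT.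
  have nx : x != par t x by apply/eqP=> /esym.
  rewrite (inj_eq perm_inj) nx => /eqP/orP[] /eqP; last by move->.
  rewrite -IH => /perm_inj pp.
  by have /negP[] := fconnect_step ltree_acyclic px; rewrite -{2}pp fconnect1.
split; last by rewrite -par_fix -aP par_root.
apply/forallP=> x; apply/forallP=> y.
by rewrite !adjE -!aP !(inj_eq perm_inj).
Qed.

End Ltree.

Lemma ltree_eq (n : nat) (N : finType) (t t' : ltree n N) : is_ltree t -> is_ltree t' ->
  par t =1 par t' -> lab t = lab t' -> t = t'.
Proof.
move=> t_tree t_tree' pp ll; have : troot t == troot t' by rewrite -par_fix // -pp par_root.
case: t t' pp ll {t_tree t_tree'} => [r p l] [r' p' l'] /= pp -> /eqP ->; congr LTree.
exact/ffunP.
Qed.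

(** * Relabeling nodes *)

Section Relabeling.
Variables (n : nat) (N : finType).
Implicit Types (g h a : {perm N}) (t : ltree n N).

Definition relabel g t : ltree n N :=
  LTree (g (troot t)) [ffun x => g (par t (g^-1%g x))] [ffun i => g (lab t i)].

Lemma forall_perm g (P : pred N) : [forall x, P x] = [forall x, P (g x)].
Proof. by apply/forallP/forallP=> Px x //; rewrite -(permKV g x). Qed.

Lemma ltree_isoE g t t' : ltree_iso g t t' = (t' == relabel g t).
Proof.
apply/and3P/eqP => [[/eqP tr /forallP tp /forallP tl]|->]; last first.
  by split=> //=; apply/forallP=> x; rewrite ffunE ?permK.
case: t' tr tp tl => r p l /= <- tp tl; congr LTree; apply/ffunP=> x.
  by rewrite ffunE (eqP (tp _)) permKV.
by rewrite ffunE (eqP (tl _)).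
Qed.

Lemma par_relabel g t x : par (relabel g t) (g x) = g (par t x).
Proof. by rewrite ffunE permK. Qed.

Lemma anc_relabel g t x y : anc (relabel g t) (g x) (g y) = anc t x y.
Proof.
apply: (fconnect_transport (A := setT) (@perm_inj _ g)) => // z _.
by rewrite par_relabel.
Qed.

Lemma child_relabel g t x y : child (relabel g t) (g x) (g y) = child t x y.
Proof. by rewrite /child par_relabel !(inj_eq perm_inj). Qed.

Lemma children_relabel g t x : children (relabel g t) (g x) = g @: children t x.
Proof.
apply/setP=> y; rewrite -(permKV g y) mem_imset ?inE ?child_relabel //.
exact: perm_inj.
Qed.

Lemma leaf_relabel g t x : leaf (relabel g t) (g x) = leaf t x.
Proof. by rewrite /leaf children_relabel imset_eq0. Qed.

Lemma is_ltree_relabel g t : is_ltree (relabel g t) = is_ltree t.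
Proof.
rewrite /is_ltree par_relabel (inj_eq perm_inj); congr [&& _, _, _, _ & _].
- by rewrite (forall_perm g); apply: eq_forallb => x; rewrite anc_relabel.
- rewrite (forall_perm g); apply: eq_forallb => x.
  by rewrite leaf_relabel children_relabel card_imset //; apply: perm_inj.
- apply/injectiveP/injectiveP => l_inj i j.
    by move=> ij; apply: l_inj; rewrite !ffunE ij.
  by rewrite !ffunE => /perm_inj/l_inj.
rewrite (forall_perm g); apply: eq_forallb => x; rewrite leaf_relabel.
congr (_ == _); apply/codomP/codomP=> -[i xi]; exists i; rewrite ?ffunE ?xi //.
by move: xi; rewrite ffunE => /perm_inj.
Qed.

Lemma is_aut_relabel g t a : is_aut (relabel g t) (a ^ g)%g = is_aut t a.
Proof.
rewrite /is_aut permJ (inj_eq perm_inj); congr (_ && _).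
rewrite (forall_perm g); apply: eq_forallb => x.
rewrite (forall_perm g); apply: eq_forallb => y.
by rewrite /adj !permJ !child_relabel.
Qed.

Lemma depth_relabel g t x : is_ltree t -> depth (relabel g t) (g x) = depth t x.
Proof.
move=> t_tree; rewrite !depth_height ?is_ltree_relabel //.
by apply: (height_transport (A := setT) (@perm_inj _ g)) => // z _; rewrite par_relabel.
Qed.

(* Every node is the ancestor of a labeled leaf, whose image is prescribed. *)
Lemma relabel_inj t : is_ltree t -> injective (relabel^~ t).
Proof.
move=> t_tree g h E; apply/permP=> x.
have [i /fconnect_iterP[k <-]] := exists_label_below t_tree x.
elim: k => [|k IHk] /=.
  by move: (congr1 (fun u => lab u i) E); rewrite !ffunE.
by rewrite -!par_relabel IHk E.
Qed.

End Relabeling.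

Lemma card_iso_classes (m : nat) (T : finType) (R : rel T) (S : {set T})
    (act : {perm 'I_m} -> T -> T) :
    equivalence_rel R -> (forall u v, R u v = [exists g, v == act g u]) ->
    (forall g u, u \in S -> act g u \in S) ->
    (forall u, u \in S -> injective (act^~ u)) ->
  #|equivalence_partition R S| * m`! = #|S|.
Proof.
move=> eqR RE actS act_inj; rewrite -(card_free_classes eqR RE actS act_inj).
by rewrite -card_Sn; congr (_ * _); apply: eq_card => g; rewrite inE.
Qed.

Section UClasses.
Variables (n m : nat).
Notation N := 'I_m.

Definition Urelabel (g : {perm N}) (u : ustruct n N) : ustruct n N :=
  (relabel g u.1, (u.2 ^ g)%g).

Lemma UisoE u v : Uiso u v = [exists g, v == Urelabel g u].
Proof.
apply: eq_existsb => g; rewrite ltree_isoE -pair_eqE /=; congr (_ && _).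
apply/forallP/eqP => [isoP|-> x]; last by rewrite permJ.
by apply/permP=> x; rewrite -(permKV g x) permJ (eqP (isoP _)).
Qed.

Lemma Urelabel_Uclass g u : u \in Uclass n N -> Urelabel g u \in Uclass n N.
Proof. by rewrite !inE /= is_ltree_relabel is_aut_relabel. Qed.

Lemma card_Uclasses (P : pred (ustruct n N)) :
    (forall g u, u \in Uclass n N -> P u -> P (Urelabel g u)) ->
  #|equivalence_partition (@Uiso n N) [set u in Uclass n N | P u]| * m`!
    = #|[set u in Uclass n N | P u]|.
Proof.
move=> Pg; apply: (card_iso_classes (act := Urelabel)).
- exact: Uiso_equiv.
- exact: UisoE.
- move=> g u; rewrite [in X in X -> _]inE => /andP[uU Pu]; rewrite inE Pg // andbT.
  exact: Urelabel_Uclass.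
- move=> [t a]; rewrite !inE => /andP[/andP[t_tree _] _] g h /(congr1 fst).
  exact: relabel_inj.
Qed.

End UClasses.

(** * The series of trees with automorphisms *)

Section TreeStructures.
Variables (n : nat) (N : finType).
Implicit Types (s : fstruct N) (u : ustruct n N).

Definition struct_of u : fstruct N := (par u.1, [ffun x => u.2 x], set0).

Lemma struct_of_tree u : u \in Uclass n N -> has_kind Tree setT (struct_of u).
Proof.
case: u => [t a]; rewrite inE => /andP[/= t_tree /(is_autP t_tree) a_aut].
apply/and3P; split; first exact: supported_setT.
  apply/forest_autP; split; [exact: ltree_acyclic|exact: ltree_branching|..] => x.
    by rewrite !ffunE a_aut.
  by move=> y; rewrite !ffunE => /perm_inj.
by rewrite has_shape_Tree setTI rootset_ltree // cards1 /has_shape /= setTI eqxx.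
Qed.

Lemma struct_of_inj :
  {in Uclass n N &, injective (fun u => (struct_of u, lab u.1))}.
Proof.
move=> [t a] [t' a']; rewrite !inE => /andP[/= t_tree _] /andP[/= t_tree' _] [pp /ffunP aa ll].
congr (_, _); first by apply: ltree_eq => // x; rewrite pp.
by apply/permP=> x; have := aa x; rewrite !ffunE.
Qed.

Lemma struct_of_surj s (l : {ffun 'I_n -> N}) :
    has_kind Tree setT s -> l \in labelings n (leafset (fpar s)) ->
  exists2 u, u \in Uclass n N & struct_of u = s /\ lab u.1 = l.
Proof.
move=> s_tree lL; have /and3P[_ s_forest /andP[/cards1P[r rootE] no_marks]] := s_tree.
have /forest_autP[p_acyclic branch a_comm a_inj] := s_forest.
rewrite setTI in rootE; pose t := LTree r (fpar s) l.
have t_tree : is_ltree t by apply/is_ltreeP.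
exists (t, perm a_inj).
  rewrite inE t_tree; apply/(is_autP t_tree) => x; rewrite !permE; exact: a_comm.
split=> //; apply: fstruct_eq => x //; first by rewrite ffunE permE.
by rewrite setTI in no_marks; rewrite (eqP no_marks).
Qed.

Lemma card_Uclass_struct (Q : fstruct N -> pred {ffun 'I_n -> N}) :
  #|[set u in Uclass n N | Q (struct_of u) (lab u.1)]| =
  \sum_(s | has_kind Tree setT s) #|[set l in labelings n (leafset (fpar s)) | Q s l]|.
Proof.
rewrite (card_fibration (B := [set s | has_kind Tree setT s])
  (fiber := fun s => [set l in labelings n (leafset (fpar s)) | Q s l])
  (base := struct_of) (coord := fun u => lab u.1)).
- by apply: eq_bigl => s; rewrite inE.
- move=> u; rewrite inE => /andP[uU Qu]; rewrite !inE struct_of_tree // Qu andbT.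
  by move: uU; rewrite inE => /andP[/lab_labelings + _]; rewrite inE.
- move=> u v; rewrite [in X in X -> _]inE => /andP[uU _].
  rewrite [in X in X -> _]inE => /andP[vU _]; exact: struct_of_inj.
move=> s l; rewrite inE => s_tree; rewrite inE => /andP[lL Ql].
have [u uU [uE lE]] := struct_of_surj s_tree lL; exists u; last by split.
by rewrite inE uU uE lE.
Qed.

End TreeStructures.

Section MarkedTrees.
Variable N : finType.
Implicit Types (s : fstruct N) (K : kind).

Lemma has_kind_pointed K s : pointed K ->
  has_kind K setT s = has_kind Tree setT (s.1, set0) &&
    (marks s \in [set [set x] | x in leafset (fpar s) & anchored K s x]).
Proof.
move=> Kp; rewrite /has_kind !supported_setT !andTb -andbA; congr (_ && _).
have -> : has_shape Tree setT (s.1, set0) = (#|rootset (fpar s)| == 1).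
  by rewrite has_shape_Tree /has_shape /= /marks /= !setTI eqxx.
have -> : (marks s \in [set [set x] | x in leafset (fpar s) & anchored K s x]) =
    [exists x in leafset (fpar s), (marks s == [set x]) && anchored K s x].
  apply/imsetP/exists_inP => [[x + ->]|[x xL /andP[/eqP mE ax]]].
    by rewrite inE => /andP[xL ax]; exists x; rewrite ?eqxx.
  by exists x; rewrite // inE xL.
by rewrite has_shape_pointed // !setTI.
Qed.

Lemma kind_count_pointed K n : pointed K ->
  kind_count N K n = \sum_(s : fstruct N | has_kind Tree setT s)
    (#|leafset (fpar s)| - is_stem K == n) * #|[set x in leafset (fpar s) | anchored K s x]|.
Proof.
move=> Kp; rewrite /kind_count (card_fibration
  (B := [set s | has_kind Tree setT s & #|leafset (fpar s)| - is_stem K == n])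
  (fiber := fun s => [set [set x] | x in leafset (fpar s) & anchored K s x])
  (base := fun s => (s.1, set0)) (coord := @marks N)).
- rewrite [LHS](eq_bigl (fun s => has_kind Tree setT s && (#|leafset (fpar s)| - is_stem K == n))).
    rewrite big_mkcondr; apply: eq_bigr => s _.
    by rewrite card_imset; [case: eqP; rewrite ?mul1n|exact: set1_inj].
  by move=> s; rewrite inE.
- move=> s; rewrite !inE has_kind_pointed // /weight setTI => /andP[/andP[s_tree mL] ->].
  by rewrite s_tree.
- by move=> [s m] [s' m'] _ _ [-> ->].
move=> s m; rewrite inE => /andP[s_tree wE] mL; have /and3P[_ _ /andP[_]] := s_tree.
rewrite setTI => /eqP no_marks; exists (s.1, m); last first.
  by case: s no_marks {s_tree wE mL} => s ms /= <-.
rewrite inE has_kind_pointed // /weight setTI wE andbT mL andbT.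
by case: s s_tree no_marks {wE mL} => s ms /= s_tree <-.
Qed.

End MarkedTrees.

Lemma kind_count_tree (N : finType) n :
  kind_count N Tree n = \sum_(s : fstruct N | has_kind Tree setT s) (#|leafset (fpar s)| == n).
Proof.
rewrite /kind_count -sum1dep_card big_mkcondr; apply: eq_bigr => s _.
by rewrite /weight setTI subn0; case: eqP.
Qed.

Lemma kind_count_pointed_tree (N : finType) n :
  kind_count N Pointed n = n * kind_count N Tree n.
Proof.
rewrite kind_count_pointed // kind_count_tree big_distrr; apply: eq_bigr => s _ /=.
rewrite subn0 mulnC; have [<-|_] := eqVneq #|_| n; last by rewrite !muln0.
by congr (_ * _); apply: eq_card => x; rewrite !inE andbT.
Qed.

Lemma card_Uclass_tree (N : finType) n :
  #|[set u in Uclass n N | predT u]| = n`! * kind_count N Tree n.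
Proof.
rewrite (card_Uclass_struct (fun _ => predT)) kind_count_tree big_distrr.
apply: eq_bigr => s _ /=; rewrite mulnC -card_labelings.
by apply: eq_card => l; rewrite inE andbT.
Qed.

Definition stem_pred (o : option bool) n (N : finType) : pred (ustruct n.+1 N) :=
  fun u => anchored (Stem o) (struct_of u) (last_leaf u.1).

Lemma stem_predE o n (N : finType) (u : ustruct n.+1 N) : u \in Uclass n.+1 N ->
  stem_pred o u = last_fixed u &&
    (if o is Some b then odd (depth u.1 (last_leaf u.1)) == b else true).
Proof.
rewrite inE => /andP[t_tree _]; rewrite /stem_pred /anchored ffunE.
by case: o => [b|] //; rewrite depth_height.
Qed.

Lemma stem_pred_relabel o n m (g : {perm 'I_m}) (u : ustruct n.+1 'I_m) :
  u \in Uclass n.+1 'I_m -> stem_pred o (Urelabel g u) = stem_pred o u.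
Proof.
move=> uU; rewrite !stem_predE ?Urelabel_Uclass // /last_fixed /last_leaf /= ffunE.
rewrite permJ (inj_eq perm_inj) depth_relabel //.
by move: uU; rewrite inE => /andP[].
Qed.

Lemma card_Uclass_stem o (N : finType) n :
  #|[set u in Uclass n.+1 N | stem_pred o u]| = n`! * kind_count N (Stem o) n.
Proof.
rewrite (card_Uclass_struct (fun s (l : {ffun 'I_n.+1 -> N}) => anchored (Stem o) s (l ord_max))).
rewrite kind_count_pointed // big_distrr; apply: eq_bigr => s _ /=.
rewrite (card_labelings_pred _ _ (anchored (Stem o) s)); set L := leafset _.
have [->|/set0Pn[x]] := eqVneq [set x in L | anchored (Stem o) s x] set0.
  by rewrite cards0 mul0n !muln0.
rewrite inE => /andP[xL _]; rewrite (cardsD1 x L) xL add1n eqSS subn1 /=.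
by rewrite mulnC -mulnA mulnCA.
Qed.

Local Open Scope ring_scope.

Lemma egf_sum_classes (classes : nat -> nat) (w : nat -> rat) n B M :
    (forall m, (classes m * m`!)%:R = n`!%:R * w m) ->
    (forall m, (B <= m)%N -> classes m = 0%N) -> (B <= M)%N ->
  (\sum_(m < B) classes m)%N%:R / n`!%:R = \sum_(m < M) m`!%:R^-1 * w m.
Proof.
move=> classesE classes0 BM.
have fact_neq0 m : m`!%:R != 0 :> rat by rewrite pnatr_eq0 -lt0n fact_gt0.
rewrite -(big_ord_widen_idx _ BM classes0) natr_sum mulr_suml; apply: eq_bigr => m _.
apply: (mulfI (fact_neq0 m)); rewrite [RHS]mulrA divff // mul1r mulrA -natrM mulnC.
by rewrite classesE mulrAC mulfV ?mul1r.
Qed.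

Lemma Ucount_series K n n' (P : forall N : finType, pred (ustruct n' N)) : (n' <= n.+1)%N ->
    (forall m (g : {perm 'I_m}) u, u \in Uclass n' 'I_m -> P _ u -> P _ (Urelabel g u)) ->
    (forall m, #|[set u in Uclass n' 'I_m | P _ u]| = (n`! * kind_count 'I_m K n)%N) ->
  (Ucount P)%:R / n`!%:R = series K n.
Proof.
move=> n'n P_relabel P_count; have card_classes m := card_Uclasses (P_relabel m).
rewrite (@seriesE _ _ (n.*2 + 3)) //.
under [RHS]eq_bigr => m _ do rewrite coef_exp_enumerator.
apply: (egf_sum_classes
  (classes := fun m => #|equivalence_partition (@Uiso n' 'I_m) [set u in Uclass n' 'I_m | P _ u]|)
  (w := fun m => (kind_count 'I_m K n)%:R)); last by rewrite -leq_double in n'n; lia.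
- by move=> m; rewrite card_classes P_count natrM.
move=> m nm; apply/eqP; rewrite -(eqn_pmul2r (fact_gt0 m)) card_classes mul0n cards_eq0.
apply/eqP/setP=> u; rewrite !inE; apply/negP=> /andP[/andP[/ltree_card + _] _].
by rewrite card_ord ltnNge nm.
Qed.

Lemma series_tree : U =1 series Tree.
Proof. by move=> n; apply: Ucount_series => // m; apply: card_Uclass_tree. Qed.

Lemma series_stem o n (P : forall N : finType, pred (ustruct n.+1 N)) :
    (forall N u, u \in Uclass n.+1 N -> P N u = stem_pred o u) ->
  egf (fun _ => Ucount P) n = series (Stem o) n.
Proof.
move=> PE; apply: Ucount_series => // [m g u uU|m].
  by rewrite !PE ?Urelabel_Uclass // stem_pred_relabel.
rewrite -card_Uclass_stem; apply: eq_card => u; rewrite inE [RHS]inE.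
by apply: andb_id2l => /PE.
Qed.

Lemma series_Ustar : Ustar =1 series (Stem None).
Proof. by move=> n; apply: series_stem => N u uU; rewrite stem_predE // andbT. Qed.

Lemma series_Uodd : Uodd =1 series (Stem (Some true)).
Proof. by move=> n; apply: series_stem => N u uU; rewrite stem_predE // eqb_id. Qed.

Lemma series_Ueven : Ueven =1 series (Stem (Some false)).
Proof. by move=> n; apply: series_stem => N u uU; rewrite stem_predE // eqbF_neg. Qed.

Lemma series_Ubullet : Ubullet =1 series Pointed.
Proof.
move=> n; have -> : series Pointed n = n%:R * series Tree n.
  rewrite /series mulr_sumr; apply: eq_bigr => m _.
  by rewrite !coef_exp_enumerator kind_count_pointed_tree natrM mulrCA.
rewrite -series_tree /Ubullet /fps_mul /fps_X /fps_deriv.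
case: n => [|n]; first by rewrite big_ord1 !mul0r.
rewrite big_ord_recl mul0r add0r big_ord_recl /= mul1r subn1 /= big1 ?addr0 // => i _.
by rewrite mul0r.
Qed.

Lemma series_Uforest : (2 * U + 1 - 'z)%fps =1 series Forest.
Proof.
move=> n; rewrite series_forest -series_tree /fps_sub /fps_add /fps_X.
congr (_ + _ - _); last by rewrite /fps_const; case: eqP.
rewrite /fps_mul big_ord_recl big1 ?addr0 ?subn0 //= => i _.
by rewrite /fps_const mul0r.
Qed.

Local Close Scope ring_scope.

(** * Deepest common ancestors *)

Section DeepestCommonAncestors.
Variables (n : nat) (N : finType) (t : ltree n N).
Implicit Types (S : {set N}) (A : {set 'I_n}).

Definition internal_nodes : {set N} := [set x | ~~ leaf t x].

Lemma is_dcaP S x : reflect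
  ({in S, forall l, anc t x l} /\ forall y, {in S, forall l, anc t y l} -> anc t y x)
  (is_dca t S x).
Proof.
apply: (iffP andP) => -[/forall_inP xS x_max]; split=> //.
  by move=> y yS; apply: (implyP (forallP x_max y)); apply/forall_inP.
by apply/forallP=> y; apply/implyP=> /forall_inP; apply: x_max.
Qed.

Hypothesis t_tree : is_ltree t.
Let p_acyclic := ltree_acyclic t_tree.

Lemma dca_unique S x y : is_dca t S x -> is_dca t S y -> x = y.
Proof.
move=> /is_dcaP[xS x_max] /is_dcaP[yS y_max].
by apply: (fconnect_anti p_acyclic); [apply: x_max|apply: y_max].
Qed.

Lemma dca_exists S : S != set0 -> exists x, is_dca t S x.
Proof.
case/set0Pn=> l0 l0S; pose P x := [forall l in S, anc t x l].
have Pr : P (troot t) by apply/forall_inP=> l _; apply: anc_root.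
case: (arg_maxnP (height (par t)) Pr) => x /forall_inP xS x_max.
exists x; apply/is_dcaP; split=> // y yS.
case/orP: (fconnect_total (xS _ l0S) (yS _ l0S)) => // yx.
have [->|/eqP xy] := eqVneq x y; first exact: connect0.
have xy_height : height (par t) y <= height (par t) x by apply: x_max; apply/forall_inP.
by have := height_lt p_acyclic yx (nesym xy); rewrite ltnNge xy_height.
Qed.

Lemma two_kids v : ~~ leaf t v ->
  exists y y', [/\ y \in kids (par t) v, y' \in kids (par t) v & y != y'].
Proof.
rewrite leafE // inE -cards_eq0 => v0.
have : 1 < #|kids (par t) v| by have := ltree_branching t_tree v; case: #|_| v0 => [|[]].
by case/card_gt1P=> y [y' [? ? ?]]; exists y, y'.
Qed.

Lemma same_labels_below u v : anc t u v ->
  (forall i, anc t u (lab t i) -> anc t v (lab t i)) -> u = v.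
Proof.
move=> uv same; apply/eqP/negPn/negP=> /eqP /nesym vu.
have [w wu vw] := fconnect_kid p_acyclic uv vu.
have ui : ~~ leaf t u by rewrite leafE // inE; apply/set0Pn; exists w.
have [y [y' [yu yu' yy]]] := two_kids ui.
have [z zu zw] : exists2 z, z \in kids (par t) u & z != w.
  by have [yw|] := eqVneq y w; [exists y'; rewrite // -yw eq_sym|exists y].
have [i zi] := exists_label_below t_tree z.
have zpar : fconnect (par t) z u by move: zu; rewrite inE => /andP[/eqP <- _]; apply: fconnect1.
have vi := same i (connect_trans zi zpar).
by case/eqP: zw; apply: (kid_above_unique p_acyclic zu wu zi); apply: connect_trans vi vw.
Qed.

Lemma labels_below_inj u v :
  (forall i, anc t u (lab t i) = anc t v (lab t i)) -> u = v.
Proof.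
move=> same; have [i ui] := exists_label_below t_tree u; have := ui; rewrite same => vi.
case/orP: (fconnect_total ui vi) => uv.
  by apply/esym/(same_labels_below uv) => j; rewrite same.
by apply: (same_labels_below uv) => j; rewrite same.
Qed.

Lemma dca_labels_internal A v :
  1 < #|A| -> is_dca t (lab t @: A) v -> v \in internal_nodes.
Proof.
case/card_gt1P=> i [j [iA jA ij]] /is_dcaP[vA _]; rewrite inE; apply/negP=> vl.
have labE l : l \in A -> lab t l = v by move=> lA; apply: leaf_minimal (vA _ _); rewrite ?imset_f.
by case/eqP: ij; apply: (lab_inj t_tree); rewrite !labE.
Qed.

Lemma internal_dca_labels v : v \in internal_nodes ->
  exists2 A : {set 'I_n}, 1 < #|A| & is_dca t (lab t @: A) v.
Proof.
rewrite inE => vi; pose A := [set i | anc t v (lab t i)]; exists A; last first.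
  apply/is_dcaP; split=> [_ /imsetP[i + ->]|y yA]; first by rewrite inE.
  have [i vi'] := exists_label_below t_tree v.
  have yi : anc t y (lab t i) by apply: yA; rewrite imset_f // inE.
  case/orP: (fconnect_total vi' yi) => // yv.
  rewrite -(same_labels_below yv) => [|j vj]; first exact: connect0.
  by apply: yA; rewrite imset_f // inE.
have [y [y' [yv yv' yy]]] := two_kids vi.
have [i yi] := exists_label_below t_tree y; have [j yj] := exists_label_below t_tree y'.
have below z l : z \in kids (par t) v -> anc t z (lab t l) -> l \in A.
  by rewrite !inE => /andP[/eqP <- _] zl; apply: connect_trans zl (fconnect1 _ _).
apply/card_gt1P; exists i, j; split; [exact: below yv yi|exact: below yv' yj|].
apply: contra yy => /eqP ij; apply/eqP/(kid_above_unique p_acyclic yv yv' yi).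
by rewrite ij.
Qed.

End DeepestCommonAncestors.

Section Cotrees.
Variables (n : nat) (N : finType) (t : cotree n N).
Hypothesis t_cotree : is_cotree t.

Lemma cotree_ltree : is_ltree t. Proof. by case/andP: t_cotree. Qed.

Lemma dec_leaf x : (dec t x == None) = leaf t x.
Proof. by case/andP: t_cotree => _ /forallP/(_ x)/eqP. Qed.

Lemma dec_internal x : ~~ leaf t x -> exists b, dec t x = Some b.
Proof. by rewrite -dec_leaf; case: (dec t x) => // b; exists b. Qed.

Lemma canonical_dec : canonical t -> forall x y, ~~ leaf t x -> ~~ leaf t y ->
  dec t x = omap (addb (odd (height (par t) x) (+) odd (height (par t) y))) (dec t y).
Proof.
have t_tree := cotree_ltree; have p_acyclic := ltree_acyclic t_tree; move=> /forallP alternate.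
have from_root x : ~~ leaf t x ->
    dec t x = omap (addb (odd (height (par t) x))) (dec t (troot t)).
  elim/(acyclic_ind p_acyclic): x => x px.
    have -> : x = troot t by apply/eqP; rewrite -par_fix // px.
    by rewrite height_fix ?par_root //; case: (dec _ _).
  have xr : x != troot t by rewrite -par_fix //; apply/eqP.
  move=> /(_ (internal_par xr)) IH xi.
  have /forallP/(_ x) := alternate (par t x); rewrite /child xr eqxx (negbTE xi) /=.
  rewrite height_step //=; have [b ->] := dec_internal xi.
  have [b' E] := dec_internal (internal_par xr); move: IH; rewrite E.
  by case: (dec t (troot t)) => //= b0 [->]; case: (odd _); case: b; case: b0.
move=> x y xi yi; rewrite (from_root x xi) (from_root y yi); case: (dec _ _) => //= b.
by congr Some; do 2 case: (odd _); case: b.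
Qed.

End Cotrees.

(** * Induced cotrees *)

Section Embeddings.
Variables (k : nat) (N0 : finType) (t0 : cotree k N0).

Definition embedding (n : nat) (N : finType) (t : cotree n N) (l : {ffun 'I_k -> N})
    (f : {ffun N0 -> N}) : bool :=
  [&& injectiveb f, [forall i, f (lab t0 i) == l i],
      f @: internal_nodes t0 == dcas t l,
      [forall x, forall y, anc t0 x y == anc t (f x) (f y)]
    & [forall x, dec t0 x == dec t (f x)]].

Section Facts.
Variables (n : nat) (N : finType) (t : cotree n N).
Implicit Types (l : {ffun 'I_k -> N}) (f : {ffun N0 -> N}).

Lemma embeddingP l f : reflect
  [/\ injective f, forall i, f (lab t0 i) = l i, dcas t l = f @: internal_nodes t0,
      forall x y, anc t (f x) (f y) = anc t0 x y & forall x, dec t (f x) = dec t0 x]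
  (embedding t l f).
Proof.
apply: (iffP and5P) => [[/injectiveP f_inj /forallP fl /eqP fD /forallP fA /forallP fd]|].
  by split=> // [i|x y|x]; apply/eqP; rewrite ?fl // eq_sym ?fd //; have /forallP := fA x.
case=> /injectiveP f_inj fl fD fA fd; split=> //; first by apply/forallP=> i; apply/eqP.
- by rewrite fD.
- by apply/forallP=> x; apply/forallP=> y; rewrite fA.
- by apply/forallP=> x; rewrite fd.
Qed.

Lemma inducesP l : reflect (exists f, embedding t l f) (induces t0 t l).
Proof. exact: existsP. Qed.

Hypothesis t0_cotree : is_cotree t0.
Let t0_tree := cotree_ltree t0_cotree.

Lemma embedding_unique l f g : embedding t l f -> embedding t l g -> f = g.
Proof.
case/embeddingP=> _ fl fD fA _ /embeddingP[_ gl gD glue_acyclic _].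
apply/ffunP=> y; have [yl|yi] := boolP (leaf t0 y).
  by move: yl; rewrite leaf_codom // => /codomP[i ->]; rewrite fl gl.
have : f y \in g @: internal_nodes t0 by rewrite -gD fD imset_f // inE.
case/imsetP=> u _ fu; rewrite fu; congr (g _); apply: (labels_below_inj t0_tree) => i.
by rewrite -glue_acyclic -fA fu gl fl.
Qed.

Lemma dcas_image l f : is_ltree t -> (forall i, f (lab t0 i) = l i) ->
    (forall (A : {set 'I_k}) v, 1 < #|A| ->
       is_dca t0 (lab t0 @: A) v -> is_dca t (l @: A) (f v)) ->
  dcas t l = f @: internal_nodes t0.
Proof.
move=> t_tree fl f_dca; apply/setP=> x; rewrite inE.
apply/existsP/imsetP => [[A /andP[A_gt1 xA]]|[v vi ->]]; last first.
  have [A A_gt1 vA] := internal_dca_labels t0_tree vi.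
  by exists A; rewrite A_gt1 f_dca.
have [|v vA] := dca_exists t0_tree (S := lab t0 @: A).
  by rewrite imset_eq0 -card_gt0 ltnW.
exists v; first exact: (dca_labels_internal t0_tree A_gt1 vA).
exact: (dca_unique t_tree xA (f_dca A v A_gt1 vA)).
Qed.

End Facts.
End Embeddings.

(** * Relabeling cotrees *)

Section VClasses.
Variables (k : nat) (N0 : finType) (t0 : cotree k N0) (n m : nat).
Notation N := 'I_m.
Implicit Types (g a : {perm N}) (t : cotree n N) (l : {ffun 'I_k -> N}).

Definition relabel_cotree g t : cotree n N :=
  Cotree (relabel g t) [ffun x => dec t (g^-1%g x)].

Definition relabel_marks g l : {ffun 'I_k -> N} := [ffun i => g (l i)].

Definition Vrelabel g (v : vstruct k n N) : vstruct k n N :=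
  (relabel_cotree g v.1.1, (v.1.2 ^ g)%g, relabel_marks g v.2).

Lemma VisoE v w : Viso v w = [exists g, w == Vrelabel g v].
Proof.
case: v w => [[t a] l] [[t' a'] l']; apply: eq_existsb => g.
rewrite ltree_isoE; apply/and4P/eqP.
  case=> /eqP tE /forallP dE /forallP aE /forallP lE; congr (_, _, _).
  - case: t' tE dE => t' d' /= -> dE; congr Cotree; apply/ffunP=> x.
    by rewrite ffunE (eqP (dE _)) permKV.
  - by apply/permP=> x; rewrite -(permKV g x) permJ (eqP (aE _)).
  - by apply/ffunP=> i; rewrite ffunE (eqP (lE _)).
rewrite /Vrelabel => -[-> -> ->]; split=> //=; apply/forallP=> x.
- by rewrite ffunE permK.
- by rewrite permJ.
- by rewrite ffunE.
Qed.

Lemma dec_relabel g t x : dec (relabel_cotree g t) (g x) = dec t x.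
Proof. by rewrite ffunE permK. Qed.

Lemma is_cotree_relabel g t : is_cotree (relabel_cotree g t) = is_cotree t.
Proof.
rewrite /is_cotree is_ltree_relabel (forall_perm g); congr (_ && _).
by apply: eq_forallb => x; rewrite dec_relabel leaf_relabel.
Qed.

Lemma canonical_relabel g t : canonical (relabel_cotree g t) = canonical t.
Proof.
rewrite /canonical (forall_perm g); apply: eq_forallb => x.
rewrite (forall_perm g); apply: eq_forallb => y.
by rewrite child_relabel leaf_relabel !dec_relabel.
Qed.

Lemma is_dca_relabel g (t : ltree n N) (S : {set N}) x :
  is_dca (relabel g t) (g @: S) (g x) = is_dca t S x.
Proof.
have allE y : [forall l in g @: S, anc (relabel g t) (g y) l] = [forall l in S, anc t y l].
  apply/forall_inP/forall_inP=> yS l.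
    by move=> lS; rewrite -(anc_relabel g) yS ?imset_f.
  by case/imsetP=> z zS ->; rewrite anc_relabel yS.
rewrite /is_dca allE; congr (_ && _); rewrite (forall_perm g); apply: eq_forallb => y.
by rewrite allE anc_relabel.
Qed.

Lemma mem_dcas_relabel g t l x :
  (g x \in dcas (relabel_cotree g t) (relabel_marks g l)) = (x \in dcas t l).
Proof.
rewrite !inE; apply: eq_existsb => A; congr (_ && _); rewrite -[RHS](is_dca_relabel g).
by congr is_dca; rewrite -imset_comp; apply: eq_imset => i; rewrite ffunE.
Qed.

Lemma embedding_relabel g t l f : embedding t0 t l f ->
  embedding t0 (relabel_cotree g t) (relabel_marks g l) [ffun x => g (f x)].
Proof.
case/embeddingP=> f_inj fl fD fA fd; apply/embeddingP; split=> [x y|i||x y|x].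
- by rewrite !ffunE => /perm_inj/f_inj.
- by rewrite !ffunE fl.
- apply/setP=> y; rewrite -(permKV g y) mem_dcas_relabel fD.
  apply/imsetP/imsetP=> -[x xi E]; exists x => //; first by rewrite ffunE E.
  by move: E; rewrite ffunE => /perm_inj.
- by rewrite !ffunE anc_relabel.
- by rewrite ffunE dec_relabel.
Qed.

Lemma fixes_dcas_relabel g t a l : fixes_dcas t a l ->
  fixes_dcas (relabel_cotree g t) (a ^ g)%g (relabel_marks g l).
Proof.
move=> /forall_inP fixed; apply/forall_inP=> y; rewrite -(permKV g y).
move: (g^-1%g y) => {}y; rewrite mem_dcas_relabel => /fixed/andP[ay /forall_inP fixed_kids].
rewrite permJ (inj_eq perm_inj) ay /=; apply/forall_inP=> z.
rewrite children_relabel => /imsetP[w wy ->]; apply/implyP=> /existsP[i].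
rewrite ffunE anc_relabel permJ (inj_eq perm_inj) => wi.
by apply: (implyP (fixed_kids w wy)); apply/existsP; exists i.
Qed.

Lemma Vrelabel_Vclass g v : v \in Vclass t0 n N -> Vrelabel g v \in Vclass t0 n N.
Proof.
case: v => [[t a] l]; rewrite !inE /= is_cotree_relabel canonical_relabel is_aut_relabel.
case/and5P=> -> -> -> /injectiveP l_inj /and3P[/forallP l_leaf /inducesP[f fE] fixed].
rewrite fixes_dcas_relabel // andbT /=; apply/and3P; split.
- by apply/injectiveP=> i j; rewrite !ffunE => /perm_inj/l_inj.
- by apply/forallP=> i; rewrite ffunE leaf_relabel.
- by apply/inducesP; eexists; apply: embedding_relabel fE.
Qed.

Lemma card_Vclasses :
  #|equivalence_partition (@Viso k n N) (Vclass t0 n N)| * m`! = #|Vclass t0 n N|.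
Proof.
apply: (card_iso_classes (act := Vrelabel)).
- exact: Viso_equiv.
- exact: VisoE.
- exact: Vrelabel_Vclass.
- move=> [[t a] l]; rewrite inE => /and3P[/andP[t_tree _] _ _] g h.
  by move/(congr1 (fun v => ctree v.1.1)); apply: relabel_inj.
Qed.

End VClasses.

(** * Gluing pieces along a cotree *)

Section Glue.
Variables (k : nat) (N0 : finType) (t0 : cotree k N0).
Notation root0 := (troot t0).

(* The color [(y, true)] is that of the stem ending in [f y], or of the tree pointed
   at [f y] when [y] is a leaf; [(y, false)] is that of the forest of the unmarked
   trees hanging from [f y], which only exists when [y] is internal. *)
Definition color_kind (i : N0 * bool) : kind :=
  let: (y, b) := i in
  if b then
    if leaf t0 y then Pointed
    else Stem (if y == root0 then None else Some (dec t0 y == dec t0 (par t0 y)))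
  else if leaf t0 y then Void else Forest.

Variable N : finType.
Implicit Types (c : {ffun N -> N0 * bool}) (s : fstruct N) (f : {ffun N0 -> N}).

Record glued c s f : Prop := Glued {
  glued_compatible : compatible c s;
  glued_forest : forest_aut (fpar s) (faut s);
  glued_color : forall y, c (f y) = (y, true);
  glued_marks : marks s = f @: setT;
  glued_leaf : forall y, f y \in leafset (fpar s);
  glued_root : forall x x' y, fpar s x = x -> fpar s x' = x' ->
    c x = (y, true) -> c x' = (y, true) -> x = x';
  glued_fixed : forall y, ~~ leaf t0 y -> faut s (f y) = f y;
  glued_parity : forall y, ~~ leaf t0 y -> y != root0 ->
    odd (height (fpar s) (f y)) = (dec t0 y == dec t0 (par t0 y));
  glued_internal : forall x y, c x = (y, false) -> ~~ leaf t0 y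
}.

Definition glue_par c s f (x : N) : N :=
  if fpar s x != x then fpar s x else if c x == (root0, true) then x
  else f (if (c x).2 then par t0 (c x).1 else (c x).1).

Definition stem_top s f (y : N0) : N := top (fpar s) (f y).

(* The leaves of the glued tree: the ends of the stems become internal nodes. *)
Definition free_leaves c s : {set N} :=
  [set x in leafset (fpar s) | ~~ ((x \in marks s) && ~~ leaf t0 (c x).1)].

Section GluePar.
Hypothesis t0_cotree : is_cotree t0.
Let t0_tree := cotree_ltree t0_cotree.
Let t0_acyclic := ltree_acyclic t0_tree.

Variables (c : {ffun N -> N0 * bool}) (s : fstruct N) (f : {ffun N0 -> N}).
Hypothesis f_glued : glued c s f.
Notation p := (fpar s).
Notation gp := (glue_par c s f).
Let c_compat := glued_compatible f_glued.

Lemma glued_acyclic : acyclic p.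
Proof. by have /forest_autP[] := glued_forest f_glued. Qed.
Let p_acyclic := glued_acyclic.

Lemma glued_branching x : #|kids p x| != 1.
Proof. by have /forest_autP[] := glued_forest f_glued. Qed.

Lemma glued_aut_par x : faut s (p x) = p (faut s x).
Proof. by have /forest_autP[] := glued_forest f_glued. Qed.

Lemma glued_aut_inj : injective (faut s).
Proof. by have /forest_autP[] := glued_forest f_glued. Qed.

Lemma glued_inj : injective f.
Proof. by move=> y y' /(congr1 c); rewrite !(glued_color f_glued) => -[]. Qed.

Lemma glued_markE x : (x \in marks s) = (x == f (c x).1).
Proof.
rewrite (glued_marks f_glued); apply/imsetP/eqP => [[y _ ->]|->].
  by rewrite (glued_color f_glued).
by exists (c x).1.
Qed.

Lemma mem_image_internal x :
  (x \in f @: internal_nodes t0) = (x \in marks s) && ~~ leaf t0 (c x).1.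
Proof.
rewrite glued_markE; apply/imsetP/andP => [[y + ->]|[/eqP xE xi]].
  by rewrite inE (glued_color f_glued).
by exists (c x).1; rewrite // inE.
Qed.

Variant glue_par_spec (x : N) : N -> Prop :=
  | GlueInner of p x <> x : glue_par_spec x (p x)
  | GlueRoot of p x = x & c x = (root0, true) : glue_par_spec x x
  | GlueStem y of p x = x & c x = (y, true) & y != root0 : glue_par_spec x (f (par t0 y))
  | GlueForest y of p x = x & c x = (y, false) & ~~ leaf t0 y : glue_par_spec x (f y).

Lemma glue_parP x : glue_par_spec x (gp x).
Proof.
rewrite /glue_par; case: (p x =P x) => [px|]; last exact: GlueInner.
case E: (c x) => [y []] /=; rewrite xpair_eqE ?andbT ?andbF; last first.
  exact: GlueForest (glued_internal f_glued E).
by case: eqP => [yr|/eqP]; [apply: GlueRoot; rewrite // E yr|apply: GlueStem].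
Qed.

Lemma glue_par_inner x : p x <> x -> gp x = p x.
Proof. by move=> px; rewrite /glue_par; case: eqP. Qed.

Lemma glue_par_root x : p x = x -> c x = (root0, true) -> gp x = x.
Proof. by move=> px cx; rewrite /glue_par px cx !eqxx. Qed.

Lemma glue_par_stem x y : p x = x -> c x = (y, true) -> y != root0 -> gp x = f (par t0 y).
Proof.
by move=> px cx yr; rewrite /glue_par px cx eqxx /= xpair_eqE (negbTE yr).
Qed.

Lemma glue_par_forest x y : p x = x -> c x = (y, false) -> gp x = f y.
Proof. by move=> px cx; rewrite /glue_par px cx eqxx /= xpair_eqE andbF. Qed.

Lemma anc_color_glue x z : fconnect gp x z -> anc t0 (c z).1 (c x).1.
Proof.
apply: (fconnect_homo (k := fun x => (c x).1) (e := fconnect (par t0))) => {z}x.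
- exact: connect0.
- by move=> y z; apply: connect_trans.
case: (glue_parP x) => [_|_ _|y _ -> _|y _ -> _]; rewrite ?(glued_color f_glued) ?connect0 //.
  by rewrite (color_par c_compat) connect0.
exact: fconnect1.
Qed.

Lemma fconnect_glue x z : fconnect p x z -> fconnect gp x z.
Proof.
apply: connect_sub => {z}x _ /eqP <-; have [->|/eqP px] := eqVneq (p x) x.
  exact: connect0.
by rewrite -(glue_par_inner px) fconnect1.
Qed.

Lemma stem_top_fix y : p (stem_top s f y) = stem_top s f y.
Proof. exact: top_fix. Qed.

Lemma color_stem_top y : c (stem_top s f y) = (y, true).
Proof. by rewrite (color_fconnect c_compat (fconnect_top p_acyclic _)) (glued_color f_glued). Qed.

Lemma stem_top_unique x y : p x = x -> c x = (y, true) -> x = stem_top s f y.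
Proof.
by move=> px cx; apply: (glued_root f_glued px _ cx); [exact: stem_top_fix|exact: color_stem_top].
Qed.

Lemma glue_par_stem_top y : y != root0 -> gp (stem_top s f y) = f (par t0 y).
Proof. exact: glue_par_stem (stem_top_fix y) (color_stem_top y). Qed.

Lemma fconnect_stem_top y : fconnect gp (f y) (stem_top s f y).
Proof. exact/fconnect_glue/fconnect_top. Qed.

Lemma fconnect_image_par y : y != root0 -> fconnect gp (f y) (f (par t0 y)).
Proof.
move=> yr; apply: connect_trans (fconnect_stem_top y) _.
by rewrite -glue_par_stem_top // fconnect1.
Qed.

Lemma fconnect_image x y : fconnect gp (f y) (f x) = anc t0 x y.
Proof.
apply/idP/idP => [/anc_color_glue|]; first by rewrite !(glued_color f_glued).
elim/(acyclic_ind t0_acyclic): y => y py; first by move/(fconnect_fix py) ->; apply: connect0.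
move=> IH; rewrite /anc fconnect_eqVf => /orP[/eqP -> |/IH]; first exact: connect0.
by apply/connect_trans/fconnect_image_par; rewrite -par_fix //; apply/eqP.
Qed.

Lemma rootset_glue : rootset gp = [set stem_top s f root0].
Proof.
apply/setP=> x; apply/rootsetP/set1P => [gx|->]; last first.
  exact: (glue_par_root (stem_top_fix _) (color_stem_top _)).
move: (gx); case: (glue_parP x) => [px|px cx|y _ cx yr|y _ cx _] fx.
- by case: px.
- exact: stem_top_unique.
- move: cx; rewrite -fx (glued_color f_glued) => -[/eqP].
  by rewrite par_fix // (negbTE yr).
- by move: cx; rewrite -fx (glued_color f_glued).
Qed.

Lemma acyclic_glue : acyclic gp.
Proof.
have /rootsetP root_fix : stem_top s f root0 \in rootset gp by rewrite rootset_glue set11.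
apply/acyclicP=> x; exists (stem_top s f root0) => //.
have from_image y : fconnect gp (f y) (stem_top s f root0).
  by apply: connect_trans (fconnect_stem_top root0); rewrite fconnect_image; apply: anc_root.
apply: connect_trans (fconnect_glue (fconnect_top p_acyclic x)) _.
have := fconnect1 gp (top p x); case: (glue_parP (top p x)) => [|px cx _|y _ _ _|y _ _ _].
- by rewrite top_fix.
- by rewrite (stem_top_unique px cx) connect0.
- by move/connect_trans; apply; apply: from_image.
- by move/connect_trans; apply; apply: from_image.
Qed.
Let glue_acyclic := acyclic_glue.

Lemma kids_glue x : x \notin f @: internal_nodes t0 -> kids gp x = kids p x.
Proof.
move=> xN; apply/setP=> w; rewrite !inE andbC [RHS]andbC; apply: andb_id2l => wx.
have image_neq v : ~~ leaf t0 v -> x != f v.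
  by move=> vi; apply: contraNneq xN => ->; rewrite imset_f // inE.
case: (glue_parP w) => [//|-> _ //|y -> _ yr|y -> _ yi].
  by rewrite (negbTE wx) eq_sym; apply/negbTE/image_neq/internal_par.
by rewrite (negbTE wx) eq_sym; apply/negbTE/image_neq.
Qed.

Lemma kid_glue_image v w : w \in kids gp (f v) ->
  p w = w /\ ((exists2 y, y \in kids (par t0) v & c w = (y, true)) \/ c w = (v, false)).
Proof.
rewrite inE => /andP[/eqP + wf]; case: (glue_parP w) => [_ pw|_ _ wE|y pw cw yr|y pw cw _].
- by have := glued_leaf f_glued v; rewrite inE => /eqP/setP/(_ w); rewrite !inE pw eqxx wf.
- by rewrite wE eqxx in wf.
- by move/glued_inj <-; split=> //; left; exists y => //; apply: mem_kids_par.
- by move/glued_inj <-; split=> //; right.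
Qed.

Lemma card_kids_glue_image v : ~~ leaf t0 v -> 1 < #|kids gp (f v)|.
Proof.
move=> vi; have [y [y' [yv yv' yy]]] := two_kids t0_tree vi.
have kid_top z : z \in kids (par t0) v -> stem_top s f z \in kids gp (f v).
  rewrite [z \in _]inE => /andP[/eqP zv zNv].
  have zr : z != root0 by rewrite -par_fix // zv eq_sym.
  rewrite inE glue_par_stem_top // zv eqxx /=; apply/eqP=> /(congr1 c).
  by rewrite color_stem_top (glued_color f_glued) => -[/eqP]; rewrite (negbTE zNv).
apply/card_gt1P; exists (stem_top s f y), (stem_top s f y'); split; try exact: kid_top.
by apply: contraNneq yy => /(congr1 c); rewrite !color_stem_top => -[->].
Qed.

Lemma glue_branching x : #|kids gp x| != 1.
Proof.
have [/imsetP[v + ->]|xN] := boolP (x \in f @: internal_nodes t0).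
  by rewrite inE => /card_kids_glue_image; case: #|_| => [|[]].
by rewrite kids_glue // glued_branching.
Qed.

Lemma leafset_glue : leafset gp = free_leaves c s.
Proof.
apply/setP=> x; rewrite inE [RHS]inE -mem_image_internal.
have [/imsetP[v + ->]|xN] := boolP (x \in f @: internal_nodes t0).
  by rewrite inE andbF => /card_kids_glue_image; rewrite -cards_eq0; case: #|_|.
by rewrite kids_glue // inE andbT.
Qed.

Lemma color_below x z : ~~ (c x).2 || leaf t0 (c x).1 -> fconnect gp z x -> c z = c x.
Proof.
move=> terminal /fconnect_iterP[j]; elim: j z => [z <- //|j IHj z]; rewrite iterSr => /IHj.
case: (glue_parP z) => [_ <-|_ _ //|y _ _ yr E|y _ _ yi E].
- by rewrite (color_par c_compat).
- by move: terminal; rewrite -E (glued_color f_glued) /= (negbTE (internal_par yr)).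
- by move: terminal; rewrite -E (glued_color f_glued) /= (negbTE yi).
Qed.

Lemma marked_below x i : fconnect gp (f (lab t0 i)) x -> (c x).2.
Proof.
move=> ix; apply/negPn/negP=> cx; have := color_below (x := x) _ ix.
by rewrite cx => /(_ isT) E; move: cx; rewrite -E (glued_color f_glued).
Qed.

Lemma height_glue x y : c x = (y, true) -> y != root0 ->
  height gp x = height p x + (height gp (f (par t0 y))).+1.
Proof.
move=> + yr; elim/(acyclic_ind p_acyclic): x => [x px cx|x px IH cx].
  have gx : gp x <> x.
    rewrite (glue_par_stem px cx yr) => /(congr1 c); rewrite (glued_color f_glued) cx => -[/eqP].
    by rewrite par_fix // (negbTE yr).
  by rewrite (height_fix px) (height_step glue_acyclic gx) (glue_par_stem px cx yr).
rewrite (height_step p_acyclic px) (height_step glue_acyclic); last by rewrite glue_par_inner.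
by rewrite glue_par_inner // IH // (color_par c_compat).
Qed.

End GluePar.
End Glue.

Section GlueCotree.
Variables (k : nat) (N0 : finType) (t0 : cotree k N0).
Hypotheses (hk : 2 <= k) (t0_cotree : is_cotree t0).
Notation root0 := (troot t0).
Let t0_tree := cotree_ltree t0_cotree.
Let t0_acyclic := ltree_acyclic t0_tree.

Lemma root_internal : ~~ leaf t0 root0.
Proof.
apply/negP=> r_leaf.
have labE i : lab t0 i = root0 by apply: leaf_minimal r_leaf (anc_root _ _).
have : Ordinal hk = Ordinal (ltnW hk) by apply: (lab_inj t0_tree); rewrite !labE.
by move/(congr1 val).
Qed.

Variables (N : finType) (c : {ffun N -> N0 * bool}) (s : fstruct N) (f : {ffun N0 -> N}).
Hypothesis f_glued : glued t0 c s f.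
Notation p := (fpar s).
Notation gp := (glue_par t0 c s f).
Let glue_acyclic := acyclic_glue t0_cotree f_glued.

Variables (n : nat) (lb : {ffun 'I_n -> N}).
Hypothesis lbL : lb \in labelings n (free_leaves t0 c s).

Definition glue_ltree : ltree n N := LTree (stem_top s f root0) [ffun x => gp x] lb.

Definition glue_cotree : cotree n N := Cotree glue_ltree
  [ffun x => if leaf glue_ltree x then None else
     omap (addb (odd (height gp x) (+) odd (height gp (f root0)))) (dec t0 root0)].

Definition glue_aut : {perm N} := perm (glued_aut_inj f_glued).

Definition glue_marks : {ffun 'I_k -> N} := [ffun i => f (lab t0 i)].

Lemma par_glue : par glue_ltree =1 gp. Proof. by move=> x; rewrite ffunE. Qed.

Lemma anc_glue x y : anc glue_ltree x y = fconnect gp y x.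
Proof. by rewrite /anc (eq_fconnect par_glue). Qed.

Lemma is_ltree_glue : is_ltree glue_ltree.
Proof.
apply/is_ltreeP; rewrite (eq_acyclic par_glue) (eq_rootset par_glue) (eq_leafset par_glue).
rewrite rootset_glue // (leafset_glue t0_cotree f_glued); split=> // x.
by rewrite (eq_kids par_glue) glue_branching.
Qed.
Let glue_tree := is_ltree_glue.

Lemma leaf_glue x : leaf glue_ltree x = (x \in free_leaves t0 c s).
Proof. by rewrite leafE // (eq_leafset par_glue) (leafset_glue t0_cotree f_glued). Qed.

Lemma leaf_glue_image y : leaf glue_ltree (f y) = leaf t0 y.
Proof.
rewrite leaf_glue inE (glued_leaf f_glued) (glued_markE f_glued) (glued_color f_glued) eqxx.
by rewrite negbK.
Qed.

Lemma is_aut_glue : is_aut glue_ltree glue_aut.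
Proof.
apply/is_autP => // x; rewrite !par_glue !permE.
have aut_fix : p x = x -> p (faut s x) = faut s x by rewrite -(glued_aut_par f_glued) => ->.
have caut := color_aut (glued_compatible f_glued) x.
case: (glue_parP f_glued x) => [px|px cx|y px cx yr|y px cx yi].
- rewrite glue_par_inner ?(glued_aut_par f_glued) // -(glued_aut_par f_glued).
  by move/(glued_aut_inj f_glued).
- by rewrite glue_par_root ?aut_fix // caut.
- rewrite (glue_par_stem _ (aut_fix px) (etrans caut cx) yr) (glued_fixed f_glued) //.
  exact: internal_par.
- by rewrite (glue_par_forest _ _ (aut_fix px) (etrans caut cx)) (glued_fixed f_glued).
Qed.

Lemma dec_glue_image y : dec glue_cotree (f y) = dec t0 y.
Proof.
rewrite ffunE leaf_glue_image; case: ifPn => [yl|].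
  by apply/esym/eqP; rewrite dec_leaf.
elim/(acyclic_ind t0_acyclic): y => y py.
  have -> : y = root0 by apply/eqP; rewrite -par_fix // py.
  by rewrite addbb; case: (dec _ _).
have yr : y != root0 by rewrite -par_fix //; apply/eqP.
move=> /(_ (internal_par yr)) IH yi.
have [b bE] := dec_internal t0_cotree yi; have [b' bE'] := dec_internal t0_cotree (internal_par yr).
have [b0 bE0] := dec_internal t0_cotree root_internal.
have := glued_parity f_glued yi yr.
rewrite (height_glue t0_cotree f_glued (glued_color f_glued y)) // oddD /= => ->.
move: IH; rewrite bE bE' bE0 /= => -[<-]; congr Some.
by do 2 case: (odd _); case: (b); case: (b0).
Qed.

Lemma is_cotree_glue : is_cotree glue_cotree.
Proof.
apply/andP; split; first exact: glue_tree.
apply/forallP=> x; rewrite ffunE; case: ifP => //.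
by have [b ->] := dec_internal t0_cotree root_internal.
Qed.

Lemma canonical_glue : canonical glue_cotree.
Proof.
apply/forallP=> x; apply/forallP=> y; apply/implyP=> xy.
have xi : leaf glue_ltree x = false by apply/negbTE/set0Pn; exists y; rewrite inE.
rewrite !ffunE xi; case: ifP => //= _.
case/andP: xy => yr /eqP px; have [b ->] /= := dec_internal t0_cotree root_internal.
have py : gp y <> y by move/eqP; rewrite -par_glue par_fix // (negbTE yr).
rewrite (height_step glue_acyclic py) -par_glue px /=.
by do 2 case: (odd _); case: b.
Qed.

Lemma dca_glue (A : {set 'I_k}) v : 1 < #|A| -> is_dca t0 (lab t0 @: A) v ->
  is_dca glue_ltree (glue_marks @: A) (f v).
Proof.
move=> A_gt1 /is_dcaP[vA v_max]; have /card_gt1P[i0 [_ [i0A _ _]]] := A_gt1.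
apply/is_dcaP; split=> [_ /imsetP[i iA ->]|z zA].
  by rewrite anc_glue ffunE (fconnect_image t0_cotree f_glued); apply: vA; apply: imset_f.
have zi i : i \in A -> fconnect gp (f (lab t0 i)) z.
  by move=> iA; rewrite -anc_glue; have := zA (glue_marks i) (imset_f _ iA); rewrite ffunE.
have vi0 : fconnect gp (f (lab t0 i0)) (f v).
  by rewrite (fconnect_image t0_cotree f_glued); apply: vA; apply: imset_f.
rewrite anc_glue; case/orP: (fconnect_total (zi i0 i0A) vi0) => // zv.
have [->|/eqP zNv] := eqVneq z (f v); first exact: connect0.
have [w wv zw] := fconnect_kid glue_acyclic zv zNv.
have wi i : i \in A -> fconnect gp (f (lab t0 i)) w by move=> /zi/connect_trans; apply.
case: (kid_glue_image t0_cotree f_glued wv) => _ [[u uv cw]|cw]; last first.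
  by have := marked_below f_glued (wi i0 i0A); rewrite cw.
have vu : anc t0 u v.
  apply: v_max => _ /imsetP[i iA ->]; have := anc_color_glue f_glued (wi i iA).
  by rewrite cw (glued_color f_glued).
move: uv; rewrite inE => /andP[/eqP pu uNv].
by rewrite -(fconnect_anti t0_acyclic vu) ?eqxx // -pu fconnect1 in uNv.
Qed.

Lemma glue_embedding : embedding t0 glue_cotree glue_marks f.
Proof.
apply/embeddingP; split=> [|i||x y|y].
- exact: glued_inj f_glued.
- by rewrite ffunE.
- by apply: dcas_image => // [i|A v]; [rewrite ffunE|exact: dca_glue].
- by rewrite anc_glue (fconnect_image t0_cotree f_glued).
- exact: dec_glue_image.
Qed.

Lemma fixes_glue : fixes_dcas glue_cotree glue_aut glue_marks.
Proof.
have /embeddingP[_ _ dcasE _ _] := glue_embedding.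
apply/forall_inP=> x; rewrite dcasE => /imsetP[v]; rewrite inE => vi ->.
rewrite permE (glued_fixed f_glued) // eqxx /=; apply/forall_inP=> w.
rewrite childrenE // (eq_kids par_glue) => wv; apply/implyP=> /existsP[i].
rewrite ffunE anc_glue permE => wi; apply/eqP.
have [pw [[u uv cw]|cw]] := kid_glue_image t0_cotree f_glued wv; last first.
  by have := marked_below f_glued wi; rewrite cw.
apply: (glued_root f_glued _ pw _ cw); first by rewrite -(glued_aut_par f_glued) pw.
by rewrite (color_aut (glued_compatible f_glued)).
Qed.

Lemma glue_Vclass : (glue_cotree, glue_aut, glue_marks) \in Vclass t0 n N.
Proof.
rewrite inE is_cotree_glue canonical_glue is_aut_glue fixes_glue andbT /=.
apply/and3P; split.
- by apply/injectiveP=> i j; rewrite !ffunE => /(glued_inj f_glued)/(lab_inj t0_tree).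
- by apply/forallP=> i; rewrite ffunE leaf_glue_image leaf_lab.
- by apply/inducesP; exists f; apply: glue_embedding.
Qed.

End GlueCotree.

(** * Cutting a cotree into pieces *)

Section Cut.
Variables (k : nat) (N0 : finType) (t0 : cotree k N0) (n : nat) (N : finType).
Notation root0 := (troot t0).

Section Definitions.
Variables (t : ltree n N) (a : {perm N}) (f : {ffun N0 -> N}).

Definition cut_par : {ffun N -> N} :=
  [ffun x => if par t x \in f @: internal_nodes t0 then x else par t x].

Definition cut_struct : fstruct N := (cut_par, [ffun x => a x], f @: setT).

Definition cut_color : {ffun N -> N0 * bool} := [ffun x =>
  let r := top cut_par x in
  if [pick y | top cut_par (f y) == r] is Some y then (y, true)
  else if [pick v | f v == par t r] is Some v then (v, false) else (root0, false)].

End Definitions.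

Variables (t : cotree n N) (a : {perm N}) (l : {ffun 'I_k -> N}) (f : {ffun N0 -> N}).
Hypotheses (hk : 2 <= k) (t0_cotree : is_cotree t0).
Hypotheses (t_cotree : is_cotree t) (t_canonical : canonical t) (a_aut : is_aut t a).
Hypotheses (fE : embedding t0 t l f) (fixed : fixes_dcas t a l).

Let t0_tree := cotree_ltree t0_cotree.
Let t_tree := cotree_ltree t_cotree.
Let t0_acyclic := ltree_acyclic t0_tree.
Let p_acyclic := ltree_acyclic t_tree.
Let f_inj : injective f. Proof. by case/embeddingP: fE. Qed.
Let f_lab i : f (lab t0 i) = l i. Proof. by case/embeddingP: fE. Qed.
Let f_anc x y : anc t (f x) (f y) = anc t0 x y. Proof. by case/embeddingP: fE. Qed.
Let f_dec x : dec t (f x) = dec t0 x. Proof. by case/embeddingP: fE. Qed.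
Let dcasE : dcas t l = f @: internal_nodes t0. Proof. by case/embeddingP: fE. Qed.

Notation p := (par t).
Notation cp := (cut_par t f).
Notation cc := (cut_color t f).
Notation cut_top y := (top cp (f y)).
Notation branching := (f @: internal_nodes t0).

Lemma leaf_embedding y : leaf t (f y) = leaf t0 y.
Proof. by rewrite -(dec_leaf t_cotree) f_dec dec_leaf. Qed.

Lemma mem_branching y : (f y \in branching) = ~~ leaf t0 y.
Proof. by rewrite mem_imset ?inE. Qed.

Lemma cut_parE x : cp x = if p x \in branching then x else p x.
Proof. by rewrite ffunE. Qed.

Lemma cut_par_inner x : cp x <> x -> p x \notin branching /\ cp x = p x.
Proof. by rewrite cut_parE; case: ifP. Qed.

Lemma cut_par_fix x : cp x = x -> p x \in branching \/ p x = x.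
Proof. by rewrite cut_parE; case: ifP => _; [left|right]. Qed.

Lemma acyclic_cut : acyclic cp.
Proof.
apply/acyclicP => x; elim/(acyclic_ind p_acyclic): x => x px.
  by exists x; rewrite ?connect0 // cut_parE px; case: ifP.
case=> y cy xy; case: (cp x =P x) => [cx|/cut_par_inner[_ cx]].
  by exists x; rewrite ?connect0.
by exists y => //; apply: connect_trans xy; rewrite -cx fconnect1.
Qed.
Let cut_acyclic := acyclic_cut.

Lemma fconnect_cut x z : fconnect cp x z -> fconnect p x z.
Proof.
apply: connect_sub => {z}x _ /eqP <-.
have [->|/eqP/cut_par_inner[_ ->]] := eqVneq (cp x) x; first exact: connect0.
exact: fconnect1.
Qed.

Lemma fconnect_cut_branching x z : fconnect cp x z -> z \in branching -> x = z.
Proof.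
move=> xz zB; apply/eqP/negPn/negP=> /eqP xNz.
have [w + _] := fconnect_kid cut_acyclic xz xNz; rewrite inE => /andP[/eqP cw /eqP wz].
have [|pw cpw] := @cut_par_inner w; first by rewrite cw => /esym.
by rewrite -cpw cw zB in pw.
Qed.

Lemma fconnect_par_cut x z : fconnect p x z ->
  fconnect cp x z \/ fconnect p (p (top cp x)) z.
Proof.
elim/(acyclic_ind cut_acyclic): x => x cx.
  by rewrite top_id // fconnect_eqVf => /orP[/eqP ->|]; [left; apply: connect0|right].
have [_ cpx] := cut_par_inner cx.
move=> IH; rewrite fconnect_eqVf => /orP[/eqP ->|]; first by left; apply: connect0.
rewrite -cpx => /IH[xz|]; last by rewrite top_step //; right.
by left; apply: connect_trans xz; apply: fconnect1.
Qed.

Lemma fconnect_cut_top y : fconnect p (f y) (cut_top y).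
Proof. exact/fconnect_cut/fconnect_top. Qed.

Lemma anc_par_cut_top y v : p (cut_top y) = f v -> anc t0 v y.
Proof.
move=> pv; rewrite -f_anc -pv; apply: connect_trans (fconnect_cut_top y) _.
exact: fconnect1.
Qed.

Lemma par_cut_top y : y != root0 ->
  p (cut_top y) = f (par t0 y) /\ p (cut_top y) <> cut_top y.
Proof.
move=> yr; have parB : f (par t0 y) \in branching by rewrite mem_branching internal_par.
have not_below : ~ fconnect cp (f y) (f (par t0 y)).
  move/fconnect_cut_branching/(_ parB)/f_inj/esym/eqP.
  by rewrite par_fix // (negbTE yr).
have below : fconnect p (f y) (f (par t0 y)) by rewrite -/(anc _ _ _) f_anc /anc fconnect1.
have {below} top_below : fconnect p (p (cut_top y)) (f (par t0 y)).
  by case: (fconnect_par_cut below).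
have top_par : p (cut_top y) <> cut_top y.
  move=> p_top; rewrite p_top in top_below; apply: not_below.
  by rewrite (fconnect_fix p_top top_below) fconnect_top.
split=> //; case: (cut_par_fix (top_fix cut_acyclic (f y))) => // /imsetP[v _ pv].
have := anc_par_cut_top pv; rewrite /anc fconnect_eqVf => /orP[/eqP yv|par_v]; last first.
  rewrite pv; congr (f _); apply: (fconnect_anti t0_acyclic) par_v.
  by move: top_below; rewrite pv -/(anc _ _ _) f_anc.
case: top_par; rewrite pv -yv; apply: (fconnect_anti p_acyclic) (fconnect_cut_top y) _.
by rewrite [in X in fconnect _ _ X]yv -pv fconnect1.
Qed.

Lemma cut_top_root : cut_top root0 = troot t.
Proof.
apply/eqP; rewrite -par_fix //; apply/eqP.
case: (cut_par_fix (top_fix cut_acyclic (f root0))) => // /imsetP[v _ pv].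
have vr := fconnect_fix (par_root t0_tree) (anc_par_cut_top pv); rewrite vr in pv.
rewrite pv; apply: (fconnect_anti p_acyclic) (fconnect_cut_top _) _.
by rewrite -{2}pv fconnect1.
Qed.

(* The deepest common ancestor of marked leaves below [f y] and [f y'] is some [f u]
   below their common [cut_top], hence strictly below [f (par t0 y)]: so [u] is below
   both [y] and [y']. *)
Lemma siblings_cut_top y y' : y != root0 -> y' != root0 -> par t0 y = par t0 y' ->
  cut_top y = cut_top y' -> y = y'.
Proof.
move=> yr yr' pyy' topE; have [p_top top_par] := par_cut_top yr.
have yv := mem_kids_par t0_tree yr; have := mem_kids_par t0_tree yr'; rewrite -pyy' => yv'.
have [i yi] := exists_label_below t0_tree y; have [j yj] := exists_label_below t0_tree y'.
have [ij|ij] := eqVneq i j; first by apply: (kid_above_unique t0_acyclic yv yv' yi); rewrite ij.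
have [|x /is_dcaP[xS x_max]] := dca_exists t_tree (S := l @: [set i; j]).
  by rewrite imset_eq0; apply/set0Pn; exists i; apply: set21.
have : x \in branching.
  rewrite -dcasE inE; apply/existsP; exists [set i; j]; rewrite cards2 ij.
  exact/is_dcaP.
case/imsetP=> u _ xE.
have ui : anc t0 u (lab t0 i) by rewrite -f_anc -xE f_lab; apply/xS/imset_f/set21.
have uj : anc t0 u (lab t0 j) by rewrite -f_anc -xE f_lab; apply/xS/imset_f/set22.
have top_above z m : anc t0 z (lab t0 m) -> fconnect p (l m) (cut_top z).
  by rewrite -f_anc f_lab => /connect_trans; apply; apply: fconnect_cut_top.
have u_top : fconnect p (f u) (cut_top y).
  rewrite -xE; apply: x_max => _ /imsetP[m + ->].
  by rewrite !inE => /orP[]/eqP ->; [|rewrite topE]; apply: top_above.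
have uv : fconnect (par t0) u (par t0 y).
  by rewrite -/(anc _ _ _) -f_anc -p_top; apply: connect_trans u_top (fconnect1 _ _).
have uNv : u <> par t0 y.
  move=> uE; case: top_par; rewrite p_top -uE; apply: (fconnect_anti p_acyclic) u_top _.
  by rewrite uE -p_top fconnect1.
apply: (kid_above_unique t0_acyclic yv yv').
  exact: (fconnect_kid_above t0_acyclic yv yi ui uv uNv).
exact: (fconnect_kid_above t0_acyclic yv' yj uj uv uNv).
Qed.

Lemma cut_top_inj : injective (fun y => cut_top y).
Proof.
move=> y y' topE; have [yr|yr] := eqVneq y root0.
  have [-> //|/par_cut_top[_]] := eqVneq y' root0.
  by rewrite -topE yr cut_top_root par_root.
have [p_top top_par] := par_cut_top yr.
have yr' : y' != root0.
  by apply/eqP=> yE; apply: top_par; rewrite topE yE cut_top_root par_root.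
apply: siblings_cut_top => //; apply: f_inj; rewrite -p_top topE.
by case: (par_cut_top yr').
Qed.

Lemma aut_par x : a (p x) = p (a x).
Proof. by move: x; apply/(is_autP t_tree). Qed.

Lemma aut_branching v : v \in branching -> a v = v.
Proof. by rewrite -dcasE => /(forall_inP fixed)/andP[/eqP]. Qed.

Lemma mem_aut_branching x : (a x \in branching) = (x \in branching).
Proof.
apply/idP/idP => [axB|xB]; last by rewrite aut_branching.
by have /perm_inj <- := aut_branching axB.
Qed.

Lemma aut_cut_top y : a (cut_top y) = cut_top y.
Proof.
have [->|yr] := eqVneq y root0.
  by rewrite cut_top_root; apply/eqP; rewrite -par_fix // -aut_par par_root.
have [p_top /eqP top_par] := par_cut_top yr.
have parD : f (par t0 y) \in dcas t l by rewrite dcasE mem_branching internal_par.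
have /andP[_ /forall_inP fixed_kids] := forall_inP fixed _ parD.
have top_kid : cut_top y \in children t (f (par t0 y)).
  by rewrite childrenE // inE -p_top eqxx eq_sym.
apply/eqP/(implyP (fixed_kids _ top_kid)); have [i yi] := exists_label_below t0_tree y.
apply/existsP; exists i; move: yi; rewrite -f_anc f_lab => /connect_trans; apply.
exact: fconnect_cut_top.
Qed.

Lemma aut_cut_par x : a (cp x) = cp (a x).
Proof. by rewrite !cut_parE -aut_par mem_aut_branching; case: ifP. Qed.

Lemma aut_top x : top cp (a x) = a (top cp x).
Proof.
apply: (top_unique cut_acyclic); first by rewrite -aut_cut_par top_fix.
apply: (fconnect_homo (k := a) (e := fconnect cp)) (fconnect_top cut_acyclic x) => [z|z y w|z].
- exact: connect0.
- exact: connect_trans.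
- by rewrite aut_cut_par fconnect1.
Qed.

Variant cut_color_spec (x : N) : N0 * bool -> Prop :=
  | CutStem y of top cp x = cut_top y : cut_color_spec x (y, true)
  | CutForest v of ~~ leaf t0 v & p (top cp x) = f v & (forall y, top cp x <> cut_top y) :
      cut_color_spec x (v, false).

Lemma cut_colorP x : cut_color_spec x (cc x).
Proof.
rewrite ffunE /=; case: pickP => [y /eqP/esym|no_stem]; first exact: CutStem.
have {}no_stem y : top cp x <> cut_top y.
  by move=> topE; have := no_stem y; rewrite topE eqxx.
case: (cut_par_fix (top_fix cut_acyclic x)) => [/imsetP[v]|p_top]; last first.
  by case: (no_stem root0); rewrite cut_top_root; apply/eqP; rewrite -par_fix // p_top.
rewrite inE => vi pv; case: pickP => [w /eqP|/(_ v)]; last by rewrite pv eqxx.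
by rewrite pv => /f_inj ->; apply: CutForest.
Qed.

Lemma cut_color_stem x y : top cp x = cut_top y -> cc x = (y, true).
Proof.
move=> topE; case: (cut_colorP x) => [y'|v _ _ /(_ y)] //.
by rewrite topE => /cut_top_inj ->.
Qed.

Lemma cut_color_forest x v : p (top cp x) = f v -> (forall y, top cp x <> cut_top y) ->
  cc x = (v, false).
Proof.
by move=> pv no_stem; case: (cut_colorP x) => [y /no_stem//|w _]; rewrite pv => /f_inj ->.
Qed.

Lemma kids_cut x : kids cp x = if x \in branching then set0 else kids p x.
Proof.
apply/setP=> w; rewrite inE cut_parE; have [xB|/negbTE xB] := boolP (x \in branching).
  rewrite inE; case: ifP => [_|/negbT pw]; first exact: andbN.
  by apply/negP=> /andP[/eqP pwx _]; rewrite pwx xB in pw.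
rewrite inE; case: ifP => [pw|//]; rewrite andbN; apply/esym/negP=> /andP[/eqP pwx _].
by rewrite pwx xB in pw.
Qed.

Lemma height_cut x : height p x = height cp x + height p (top cp x).
Proof.
elim/(acyclic_ind cut_acyclic): x => x cx; first by rewrite top_id // (height_fix cx).
have [_ cpx] := cut_par_inner cx; move=> IH.
by rewrite (height_step cut_acyclic cx) (height_step (p := p) p_acyclic) -?cpx ?IH ?top_step.
Qed.

Lemma compatible_cut : compatible cc (cut_struct t a f).
Proof.
have same_color x x' : top cp x = top cp x' -> cc x = cc x' by rewrite !ffunE /= => ->.
apply/forallP=> x; apply/andP; split; apply/eqP; first by apply: same_color; rewrite top_step.
rewrite [faut _ x]ffunE; case: (cut_colorP x) => [y topE|v vi pv no_stem].
  by apply: cut_color_stem; rewrite aut_top topE aut_cut_top.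
apply: cut_color_forest => [|y]; first by rewrite aut_top -aut_par pv aut_branching ?mem_branching.
by rewrite aut_top -aut_cut_top => /perm_inj; apply: no_stem.
Qed.

Lemma forest_aut_cut : forest_aut cp [ffun x => a x].
Proof.
have aE x : [ffun x => a x] x = a x by rewrite ffunE.
apply/forest_autP; split=> [|x|x|x y]; rewrite ?aE.
- exact: cut_acyclic.
- by rewrite kids_cut; case: ifP => _; rewrite ?cards0 ?ltree_branching.
- exact: aut_cut_par.
- exact: perm_inj.
Qed.

Lemma cut_parity y : ~~ leaf t0 y -> y != root0 ->
  odd (height cp (f y)) = (dec t0 y == dec t0 (par t0 y)).
Proof.
move=> yi yr; have [p_top top_par] := par_cut_top yr.
have := canonical_dec t_cotree t_canonical (x := f y) (y := f (par t0 y)).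
rewrite !leaf_embedding yi internal_par // => /(_ isT isT); rewrite !f_dec.
have [b ->] := dec_internal t0_cotree yi.
have [b' ->] /= := dec_internal t0_cotree (internal_par yr).
rewrite (height_cut (f y)) (height_step p_acyclic top_par) p_top oddD /= => -[->].
by do 2 case: (odd _); case: b'.
Qed.

Lemma cut_glued : glued t0 cc (cut_struct t a f) f.
Proof.
split=> [||y|//|y|x x' y cx cx'|y yi|y yi yr|x v].
- exact: compatible_cut.
- exact: forest_aut_cut.
- exact: cut_color_stem.
- rewrite inE kids_cut mem_branching; case: ifPn => // /negPn.
  by rewrite -leaf_embedding leafE // inE.
- case: (cut_colorP x) => // y1 xE [<-]; case: (cut_colorP x') => // y2 x'E [y2E].
  by rewrite -(top_id cut_acyclic cx) -(top_id cut_acyclic cx') xE x'E y2E.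
- by rewrite ffunE aut_branching // mem_branching.
- exact: cut_parity.
- by case: (cut_colorP x) => // w wi _ _ [<-].
Qed.

Lemma glue_cut : glue_par t0 cc (cut_struct t a f) f =1 p.
Proof.
move=> x; case: (glue_parP cut_glued x) => [/cut_par_inner[_ ->]//|cx|y cx|v cx].
- move/(stem_top_unique cut_glued cx) => ->.
  by rewrite /stem_top [LHS]cut_top_root [in RHS]cut_top_root par_root.
- move/(stem_top_unique cut_glued cx) => -> yr.
  by rewrite /stem_top; case: (par_cut_top yr).
- by case: (cut_colorP x) => // w _; rewrite top_id // => -> _ [->].
Qed.

Lemma free_leaves_cut : free_leaves t0 cc (cut_struct t a f) = leafset p.
Proof. by rewrite -(leafset_glue t0_cotree cut_glued) (eq_leafset glue_cut). Qed.

Lemma canonical_decE x : dec t x = if leaf t x then None else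
  omap (addb (odd (height p x) (+) odd (height p (f root0)))) (dec t0 root0).
Proof.
case: ifPn => [xl|xi]; first by apply/eqP; rewrite dec_leaf.
rewrite (canonical_dec t_cotree t_canonical xi (y := f root0)) ?f_dec //.
by rewrite leaf_embedding root_internal.
Qed.

End Cut.

(** * Counting marked cotrees *)

Section GoodColorings.
Variables (k : nat) (N0 : finType) (t0 : cotree k N0).
Hypotheses (hk : 2 <= k) (t0_cotree : is_cotree t0).
Notation root0 := (troot t0).
Variable N : finType.
Implicit Types (c : {ffun N -> N0 * bool}) (s : fstruct N) (f : {ffun N0 -> N}).

Lemma pointed_color y : pointed (color_kind t0 (y, true)).
Proof. by rewrite /=; case: (leaf t0 y). Qed.

Lemma is_stem_color y b : is_stem (color_kind t0 (y, b)) = b && ~~ leaf t0 y.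
Proof. by rewrite /=; case: b; case: (leaf t0 y). Qed.

Lemma anchored_color s y x : anchored (color_kind t0 (y, true)) s x =
  (leaf t0 y || (faut s x == x) &&
    ((y == root0) || (odd (height (fpar s) x) == (dec t0 y == dec t0 (par t0 y))))).
Proof. by rewrite /=; case: (leaf t0 y) => //=; case: (y == root0). Qed.

Lemma good_coloring_anchor c s y : good_coloring c (color_kind t0) s ->
  exists x, [/\ c x = (y, true), x \in leafset (fpar s),
    forall z, c z = (y, true) -> (z \in marks s) = (z == x)
    & anchored (color_kind t0 (y, true)) s x].
Proof.
case/and3P=> _ _ /forallP/(_ (y, true)); rewrite has_shape_pointed ?pointed_color //.
case/andP=> _ /exists_inP[x]; rewrite !inE => /andP[/eqP cx xl] /andP[/eqP markE ax].
exists x; split; rewrite ?inE // => z cz.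
by have /setP/(_ z) := markE; rewrite !inE cz eqxx.
Qed.

Lemma good_coloring_glued c s :
  good_coloring c (color_kind t0) s -> exists f, glued t0 c s f.
Proof.
move=> good; have [f' f'P] := fin_all_exists (fun y => good_coloring_anchor y good).
pose f := [ffun y => f' y]; exists f; have {f'P} fP y : [/\ c (f y) = (y, true),
    f y \in leafset (fpar s), forall z, c z = (y, true) -> (z \in marks s) = (z == f y)
  & anchored (color_kind t0 (y, true)) s (f y)] by rewrite ffunE.
have /and3P[c_compat s_forest /forallP shapes] := good.
split=> // [y||y|x x' y px px' cx cx'|y yi|y yi yr|x y cx].
- by case: (fP y).
- apply/setP=> x; apply/idP/imsetP => [xm|[y _ ->]]; last first.
    by case: (fP y) => cy _ /(_ (f y) cy) -> _.
  case E: (c x) => [y [|]]; last first.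
    have /andP[_] := shapes (y, false); rewrite /=; case: ifP => _ /eqP/setP/(_ x).
      by rewrite !inE E eqxx.
    by rewrite !inE E eqxx xm.
  by exists y => //; apply/eqP; case: (fP y) => _ _ <-.
- by case: (fP y).
- have := shapes (y, true); rewrite has_shape_pointed ?pointed_color //.
  case/andP=> /cards1P[r rootE] _.
  have root_eq z : c z = (y, true) -> fpar s z = z -> z = r.
    by move=> cz pz; apply/set1P; rewrite -rootE !inE cz pz !eqxx.
  by rewrite (root_eq x) // (root_eq x').
- by case: (fP y) => _ _ _; rewrite anchored_color (negbTE yi) => /andP[/eqP].
- case: (fP y) => _ _ _; rewrite anchored_color (negbTE yi) (negbTE yr).
  by case/andP=> _ /eqP.
apply/negP=> yl; have /andP[_] := shapes (y, false); rewrite /= yl => /eqP/setP/(_ x).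
by rewrite !inE cx eqxx.
Qed.

Lemma glued_has_shape c s f i : glued t0 c s f ->
  has_shape (color_kind t0 i) (color_class c i) s.
Proof.
move=> f_glued; case: i => y [|]; last first.
  rewrite /=; case: ifPn => yl /=; apply/eqP/setP=> x; rewrite !inE.
    apply/eqP => cx; have := glued_internal f_glued cx.
    by rewrite yl.
  apply/negP=> /andP[/eqP cx]; rewrite (glued_markE f_glued) => /eqP xE.
  by have := glued_color f_glued (c x).1; rewrite -xE cx.
rewrite has_shape_pointed ?pointed_color //; apply/andP; split.
  apply/cards1P; exists (stem_top s f y); apply/setP=> x; rewrite !inE.
  apply/andP/eqP => [[/eqP cx /eqP px]|->]; first exact: (stem_top_unique f_glued).
  by rewrite (color_stem_top f_glued) (stem_top_fix f_glued) !eqxx.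
apply/exists_inP; exists (f y).
  by rewrite in_setI (glued_leaf f_glued) inE (glued_color f_glued) eqxx.
rewrite anchored_color; apply/andP; split.
  apply/eqP/setP=> x; rewrite !inE (glued_markE f_glued); apply/andP/eqP => [[/eqP -> /eqP //]|->].
  by rewrite (glued_color f_glued) !eqxx.
have [//|yi /=] := boolP (leaf t0 y); rewrite (glued_fixed f_glued) // eqxx /=.
by have [//|yr] := eqVneq y root0; rewrite (glued_parity f_glued) // eqxx.
Qed.

Lemma good_coloringP c s :
  reflect (exists f, glued t0 c s f) (good_coloring c (color_kind t0) s).
Proof.
apply: (iffP idP) => [|[f f_glued]]; first exact: good_coloring_glued.
apply/and3P; split; [exact: glued_compatible f_glued|exact: glued_forest f_glued|].
by apply/forallP=> i; apply: glued_has_shape f_glued.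
Qed.

Lemma mem_free_leaves c s f x y b : glued t0 c s f -> c x = (y, b) ->
  (x \in free_leaves t0 c s) = (x \in leafset (fpar s)) && ~~ [&& b, ~~ leaf t0 y & x == f y].
Proof.
move=> f_glued cx; rewrite [LHS]in_set (glued_markE f_glued) cx /=; congr (_ && ~~ _).
case: b cx => /= cx; first exact: andbC.
by case: eqP => // xE; move: cx; rewrite xE (glued_color f_glued).
Qed.

Lemma sum_weight_colors c s : good_coloring c (color_kind t0) s ->
  \sum_i weight (color_kind t0 i) (color_class c i) s = #|free_leaves t0 c s|.
Proof.
case/good_coloringP=> f f_glued; rewrite -[RHS]sum1_card (partition_big c predT) //=.
apply: eq_bigr => -[y b] _; rewrite sum1dep_card /weight is_stem_color.
set A := _ :&: _; have memE x : (x \in free_leaves t0 c s) && (c x == (y, b)) =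
    (x \in A) && ~~ [&& b, ~~ leaf t0 y & x == f y].
  rewrite in_setI [x \in color_class _ _]in_set andbC -andbA; apply: andb_id2l => /eqP cx.
  exact: mem_free_leaves.
have [/andP[bT yi]|not_stem] := boolP (b && ~~ leaf t0 y); last first.
  rewrite subn0; apply: eq_card => x; rewrite [RHS]inE memE andbA (negbTE not_stem).
  by rewrite andbT.
have fyA : f y \in A by rewrite in_setI (glued_leaf f_glued) inE (glued_color f_glued) bT eqxx.
rewrite (cardsD1 (f y) A) fyA addKn; apply: eq_card => x.
by rewrite [RHS]inE memE bT yi !inE andbC.
Qed.

Variable n : nat.

Definition cut_pair (v : vstruct k n N) : {ffun N -> N0 * bool} * fstruct N :=
  let: (t, a, l) := v in
  if [pick f | embedding t0 t l f] is Some f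
  then (cut_color t0 t f, cut_struct t0 t a f)
  else ([ffun=> (root0, true)], ([ffun x => x], [ffun x => x], set0)).

Definition glueable : {set {ffun N -> N0 * bool} * fstruct N} :=
  [set u | good_coloring u.1 (color_kind t0) u.2 & #|free_leaves t0 u.1 u.2| == n].

Lemma cut_pairE (t : cotree n N) a l f : embedding t0 t l f ->
  cut_pair (t, a, l) = (cut_color t0 t f, cut_struct t0 t a f).
Proof.
move=> fE; rewrite /cut_pair; case: pickP => [g gE|/(_ f)]; last by rewrite fE.
by rewrite (embedding_unique t0_cotree fE gE).
Qed.

Lemma VclassP t a l : (t, a, l) \in Vclass t0 n N ->
  [/\ is_cotree t, canonical t, is_aut t a, fixes_dcas t a l
    & exists f, embedding t0 t l f].
Proof. by rewrite inE => /and5P[-> -> -> _ /and3P[_ /inducesP fE ->]]. Qed.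

Lemma cut_pair_glueable v : v \in Vclass t0 n N ->
  cut_pair v \in glueable /\
  lab v.1.1 \in labelings n (free_leaves t0 (cut_pair v).1 (cut_pair v).2).
Proof.
case: v => [[t a] l] /VclassP[t_cotree t_canonical a_aut fixed [f fE]]; rewrite (cut_pairE _ fE) /=.
have f_glued := cut_glued t0_cotree t_cotree t_canonical a_aut fE fixed.
have t_tree := cotree_ltree t_cotree.
rewrite inE /= (free_leaves_cut t0_cotree t_cotree t_canonical a_aut fE fixed) lab_labelings //.
rewrite (labelings_card (lab_labelings t_tree)) eqxx andbT; split=> //.
by apply/good_coloringP; exists f.
Qed.

Lemma cut_pair_inj :
  {in Vclass t0 n N &, injective (fun v => (cut_pair v, lab v.1.1))}.
Proof.
case=> [[t a] l] [[t' a'] l'] /VclassP[t_cotree t_canonical a_aut fixed [f fE]].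
case/VclassP=> t_cotree' t_canonical' a_aut' fixed' [f' fE'].
rewrite (cut_pairE _ fE) (cut_pairE _ fE') /= => E.
have colorE : cut_color t0 t f = cut_color t0 t' f' := congr1 (fun u => u.1.1) E.
have structE : cut_struct t0 t a f = cut_struct t0 t' a' f' := congr1 (fun u => u.1.2) E.
have labE : lab t = lab t' := congr1 snd E.
have f_glued := cut_glued t0_cotree t_cotree t_canonical a_aut fE fixed.
have f_glued' := cut_glued t0_cotree t_cotree' t_canonical' a_aut' fE' fixed'.
have ff' : f = f'.
  apply/ffunP=> y; apply/esym/eqP; have := glued_markE f_glued (f' y).
  rewrite colorE (glued_color f_glued') structE (glued_markE f_glued').
  by rewrite (glued_color f_glued') eqxx => <-.
subst f'; have parE : par t =1 par t'.
  move=> x; rewrite -(glue_cut t0_cotree t_cotree t_canonical a_aut fE fixed).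
  by rewrite -(glue_cut t0_cotree t_cotree' t_canonical' a_aut' fE' fixed') colorE structE.
have treeE : ctree t = ctree t' by apply: ltree_eq; rewrite ?cotree_ltree.
congr (_, _, _).
- have decE : dec t = dec t'.
    apply/ffunP=> x; rewrite (canonical_decE hk t0_cotree t_cotree t_canonical fE).
    by rewrite (canonical_decE hk t0_cotree t_cotree' t_canonical' fE') treeE.
  by case: (t) (t') treeE decE => [u d] [u' d'] /= -> ->.
- by apply/permP=> x; have /ffunP/(_ x) := congr1 (fun u => faut u) structE; rewrite !ffunE.
- apply/ffunP=> i; have /embeddingP[_ <- _ _ _] := fE.
  by have /embeddingP[_ <- _ _ _] := fE'.
Qed.

Section CutGlue.
Variables (c : {ffun N -> N0 * bool}) (s : fstruct N) (f : {ffun N0 -> N}).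
Hypothesis f_glued : glued t0 c s f.
Variable lb : {ffun 'I_n -> N}.
Hypothesis lbL : lb \in labelings n (free_leaves t0 c s).
Notation t := (glue_cotree t0 c s f lb).

Lemma cut_par_glue : cut_par t0 t f =1 fpar s.
Proof.
move=> x; rewrite ffunE par_glue; have p_acyclic := glued_acyclic f_glued.
case: (glue_parP f_glued x) => [px|px cx|y px cx yr|y px cx yi].
- rewrite (mem_image_internal f_glued) (glued_markE f_glued); case: eqP => //= fE.
  have := glued_leaf f_glued (c (fpar s x)).1; rewrite -fE inE => /eqP/setP/(_ x).
  by rewrite !inE eqxx /= => /negbT; rewrite negbK => /eqP/esym/px.
- by rewrite px if_same.
- by rewrite px imset_f // inE internal_par.
- by rewrite px imset_f // inE.
Qed.

Lemma cut_struct_glue : cut_struct t0 t (glue_aut f_glued) f = s.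
Proof.
apply: fstruct_eq => [|x|x]; first exact: cut_par_glue.
  by rewrite ffunE permE.
by rewrite (glued_marks f_glued).
Qed.

Lemma cut_color_glue : cut_color t0 t f = c.
Proof.
have [t_cotree _ _ _ _] := VclassP (glue_Vclass hk t0_cotree f_glued lbL).
have fE := glue_embedding hk t0_cotree f_glued lbL.
have topE z : top (cut_par t0 t f) z = top (fpar s) z.
  by rewrite -[cut_par _ _ _]/(fpar (cut_struct t0 t (glue_aut f_glued) f)) cut_struct_glue.
have p_acyclic := glued_acyclic f_glued.
apply/ffunP=> x; have px := top_fix p_acyclic x.
have cx := color_fconnect (glued_compatible f_glued) (fconnect_top p_acyclic x).
case: (cut_colorP t0_cotree t_cotree fE x) => [y|v vi]; rewrite !topE.
  by move=> xy; rewrite -cx xy -/(stem_top s f y) (color_stem_top f_glued).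
rewrite par_glue => pv no_stem; case E: (c x) => [y [|]]; rewrite E in cx.
  by case: (no_stem y); rewrite topE; apply: (stem_top_unique f_glued px cx).
by congr (_, _); apply: (glued_inj f_glued); rewrite -pv (glue_par_forest _ _ px cx).
Qed.

End CutGlue.

Lemma cut_pair_surj u lb : u \in glueable -> lb \in labelings n (free_leaves t0 u.1 u.2) ->
  exists2 v, v \in Vclass t0 n N & cut_pair v = u /\ lab v.1.1 = lb.
Proof.
case: u => c s; rewrite inE => /andP[/good_coloringP[f f_glued] _] /= lbL.
exists (glue_cotree t0 c s f lb, glue_aut f_glued, glue_marks t0 f); first exact: glue_Vclass.
split=> //; rewrite (cut_pairE _ (glue_embedding hk t0_cotree f_glued lbL)).
by rewrite cut_struct_glue cut_color_glue.
Qed.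

Lemma card_Vclass : #|Vclass t0 n N| = n`! * #|glueable|.
Proof.
rewrite (card_fibration cut_pair_glueable cut_pair_inj cut_pair_surj).
rewrite mulnC -sum_nat_const; apply: eq_bigr => u; rewrite inE => /andP[_ free_n].
by rewrite card_labelings free_n mul1n.
Qed.

End GoodColorings.

(** * The product formula *)

Section ProductOverColors.
Variables (k : nat) (N0 : finType) (t0 : cotree k N0).
Hypotheses (hk : (2 <= k)%N) (t0_cotree : is_cotree t0).
Notation root0 := (troot t0).

Lemma card_leaves : #|[pred y | leaf t0 y]| = k.
Proof.
have t0_tree := cotree_ltree t0_cotree; rewrite -[RHS](labelings_card (lab_labelings t0_tree)).
by apply: eq_card => y; rewrite !unfold_in leafE.
Qed.

Lemma card_int_edges (P : rel (option bool)) :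
  #|[set e in int_edges t0 | P (dec t0 e.1) (dec t0 e.2)]| =
  #|[pred y | ~~ leaf t0 y && (y != root0) & P (dec t0 (par t0 y)) (dec t0 y)]|.
Proof.
have edge_inj : injective (fun y => (par t0 y, y)) by move=> y y' [].
rewrite -(card_image edge_inj); apply: eq_card => -[x y]; rewrite !inE /=.
apply/andP/imageP => [[/and3P[/andP[yr /eqP px] xi yi] xy]|[y']].
  by exists y; rewrite ?inE ?px // yi yr.
rewrite inE => /andP[/andP[yi yr] xy] [-> ->]; split=> //.
by rewrite /child yr eqxx yi internal_par.
Qed.

Local Open Scope ring_scope.
Variables (R : comNzRingType) (Q : kind -> R).

Lemma prod_forest_colors : Q Void = 1 ->
  \prod_y Q (color_kind t0 (y, false)) = Q Forest ^+ n_int t0.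
Proof.
move=> Q_void; rewrite (bigID (leaf t0)) /= big1 => [|y ->] //; rewrite mul1r.
rewrite (eq_bigr (fun=> Q Forest)) => [|y /negbTE -> //].
by rewrite prodr_const /n_int cardsE.
Qed.

Lemma prod_stem_colors :
  \prod_(y | ~~ leaf t0 y && (y != root0)) Q (color_kind t0 (y, true)) =
    Q (Stem (Some true)) ^+ n_eq t0 * Q (Stem (Some false)) ^+ n_neq t0.
Proof.
rewrite (bigID (fun y => dec t0 (par t0 y) == dec t0 y)) /=; congr (_ * _).
  rewrite (eq_bigr (fun=> Q (Stem (Some true)))) => [|y]; last first.
    by move=> /andP[/andP[/negbTE -> /negbTE ->]]; rewrite eq_sym => ->.
  by rewrite prodr_const /n_eq (card_int_edges eq_op).
rewrite (eq_bigr (fun=> Q (Stem (Some false)))) => [|y]; last first.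
  by move=> /andP[/andP[/negbTE -> /negbTE ->]]; rewrite eq_sym => /negbTE ->.
by rewrite prodr_const /n_neq (card_int_edges (fun b b' => b != b')).
Qed.

Lemma prod_marked_colors :
  \prod_y Q (color_kind t0 (y, true)) =
    Q Pointed ^+ k * (Q (Stem None)
      * (Q (Stem (Some true)) ^+ n_eq t0 * Q (Stem (Some false)) ^+ n_neq t0)).
Proof.
rewrite (bigID (leaf t0)) /=; congr (_ * _).
  rewrite (eq_bigr (fun=> Q Pointed)) => [|y -> //].
  by rewrite prodr_const card_leaves.
rewrite (bigD1 root0) /=; last exact: root_internal.
by rewrite (negbTE (root_internal hk t0_cotree)) eqxx prod_stem_colors.
Qed.

Lemma prod_color_kind : Q Void = 1 ->
  \prod_i Q (color_kind t0 i) =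
    Q (Stem None) * Q Forest ^+ n_int t0 * Q Pointed ^+ k
      * Q (Stem (Some true)) ^+ n_eq t0 * Q (Stem (Some false)) ^+ n_neq t0.
Proof.
move=> Q_void; rewrite (eq_bigr (fun i => Q (color_kind t0 (i.1, i.2)))) => [|[] //].
rewrite -(pair_bigA _ (fun y b => Q (color_kind t0 (y, b)))) /=.
under eq_bigr => y _ do rewrite big_bool.
rewrite big_split prod_marked_colors prod_forest_colors //=; ring.
Qed.

End ProductOverColors.

Local Open Scope ring_scope.

Lemma coef_sum_enumerator_colorings (k : nat) (N0 : finType) (t0 : cotree k N0) (N : finType) n :
    (2 <= k)%N -> is_cotree t0 ->
  (\sum_(c : {ffun N -> N0 * bool}) \prod_i enumerator (color_kind t0 i) (color_class c i))`_n
    = #|glueable t0 N n|%:R.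
Proof.
move=> hk t0_cotree; under eq_bigr => c _ do rewrite prod_enumerator.
rewrite pair_big_dep coef_sum -sum1dep_card natr_sum big_mkcondr [RHS]big_mkcond /=.
rewrite [LHS]big_mkcond; apply: eq_bigr => -[c s] _ /=; case: ifP => // good.
by rewrite sum_weight_colors // coefXn eq_sym; case: eqP.
Qed.

Lemma V_product (k : nat) (N0 : finType) (t0 : cotree k N0) n M :
    (2 <= k)%N -> is_cotree t0 -> (n.*2 + (#|{: N0 * bool}| * 2 + 3) <= M)%N ->
  V t0 n = (\prod_i \sum_(m < M) exp_enumerator (color_kind t0 i) m)`_n.
Proof.
move=> hk t0_cotree nM; rewrite -sum_enumerator_colorings //.
under [RHS]eq_bigr => m _ do rewrite coef_sum_enumerator_colorings //.
apply: (egf_sum_classes (w := fun m => #|glueable t0 'I_m n|%:R)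
  (classes := fun m => #|equivalence_partition (@Viso k n 'I_m) (Vclass t0 n 'I_m)|)).
- by move=> m; rewrite card_Vclasses card_Vclass // natrM.
- move=> m nm; apply/eqP; rewrite -(eqn_pmul2r (fact_gt0 m)) card_Vclasses mul0n cards_eq0.
  apply/eqP/setP=> -[[t a] l]; rewrite !inE; apply/negP=> /and3P[/andP[/ltree_card + _] _ _].
  by rewrite card_ord ltnNge nm.
- by apply: leq_trans nM; apply: leq_addr.
Qed.

Theorem theorem6p4 (k : nat) (N0 : finType) (t0 : cotree k N0)
    (hk : (2 <= k)%N) (ht0 : is_cotree t0) :
  V t0 =1
    (Ustar * (2 * U + 1 - 'z) ^+ n_int t0 * Ubullet ^+ k
       * Uodd ^+ n_eq t0 * Ueven ^+ n_neq t0)%fps.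
Proof.
move=> n; set M := (n.*2 + (#|{: N0 * bool}| * 2 + 3))%N.
have nM : (n.*2 + 3 <= M)%N by rewrite leq_add2l leq_addl.
rewrite (V_product hk ht0 (leqnn M)).
rewrite (prod_color_kind hk ht0 (Q := fun K => \sum_(m < M) exp_enumerator K m)); last first.
  by apply: sum_exp_enumerator_void; lia.
have agree_kind K f : f =1 series K -> agree n f (\sum_(m < M) exp_enumerator K m).
  by move=> fK; apply: agree_ext (agree_series K nM) => e.
apply/esym; apply: (_ : agree n _ _) (leqnn n).
apply: agree_mul; last exact: agree_exp (agree_kind _ _ series_Ueven).
apply: agree_mul; last exact: agree_exp (agree_kind _ _ series_Uodd).
apply: agree_mul; last exact: agree_exp (agree_kind _ _ series_Ubullet).
apply: agree_mul; last exact: agree_exp (agree_kind _ _ series_Uforest).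
exact: agree_kind series_Ustar.
Qed.
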